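(* Let $\{\boldsymbol{\xi}_t\}_{0\le t\le 1}$ be an $n$-dimensional GLP with generating law $\nu$ and activity parameter $\mathbf{m}$. Then $\{\boldsymbol{\xi}_t\}_{0\le t\le1}$ is a Markov process with transition law given by $$\mathbb{P}\big(\xi^{(1)}_1\in dz_1,\dots,\xi^{(n-1)}_1\in dz_{n-1},\,\xi^{(n)}_1\in B\,\big|\,\boldsymbol{\xi}_s=\mathbf{x}\big)=\frac{\theta_{\tau(s)}\big(B+\sum_{i=1}^{n-1}z_i;\;x_n+\sum_{i=1}^{n-1}z_i\big)}{\Theta_s(\mathbf{1}\cdot\mathbf{x})}\prod_{i=1}^{n-1}f_{(1-s)m_i}(z_i-x_i)\,dz_i$$ and $$\mathbb{P}(\boldsymbol{\xi}_t\in d\mathbf{y}\mid\boldsymbol{\xi}_s=\mathbf{x})=\frac{\Theta_t(\mathbf{1}\cdot\mathbf{y})}{\Theta_s(\mathbf{1}\cdot\mathbf{x})}\prod_{i=1}^n f_{(t-s)m_i}(y_i-x_i)\,dy_i,$$ where $\mathbf{x},\mathbf{y}\in\mathbb{R}^n$, $\tau(t)=1-m_n(1-t)/(\mathbf{1}\cdot\mathbf{m})$, $0\le s<t<1$, and $B\in\mathcal{B}(\mathbb{R})$.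
   Context: For $\mathbf{x}\in\mathbb{R}^n$ write $\mathbf{1}\cdot\mathbf{x}=\sum_i x_i$; for $B\subset\mathbb{R}$, $x\in\mathbb{R}$, $B+x=\{y:y-x\in B\}$. All processes are càdlàg on a probability space $(\Omega,\mathcal{F},\mathbb{P})$. Lévy random bridge (LRB). Let $T>0$, let $\nu$ be a probability law on $\mathbb{R}$, and let $\{X_t\}$ be a real-valued Lévy process such that $X_t$ has a density $f_t$ for all $t\in(0,T]$, with $f_t(x)=\int_{\mathbb{R}}f_{t-s}(x-y)f_s(y)\,dy$ for $0<s<t\le T$, $x\in\mathbb{R}$, and $0<f_T(z)<\infty$ for $\nu$-a.e. $z$. A process $\{L_t\}_{0\le t\le T}$ is an LRB with generating law $\nu$ if $L_T$ has law $\nu$ and, for all $k\ge 1$, $0<t_1<\cdots<t_k<T$, $(x_1,\dots,x_k)\in\mathbb{R}^k$ and $\nu$-a.e. $z$, $\mathbb{P}(L_{t_1}\le x_1,\dots,L_{t_k}\le x_k\mid L_T=z)=\mathbb{P}(X_{t_1}\le x_1,\dots,X_{t_k}\le x_k\mid X_T=z)$. Equivalently (with $t_0=0$, $x_0=0$), $$\mathbb{P}(L_{t_1}\in dx_1,\dots,L_{t_k}\in dx_k,L_T\in dz)=\prod_{i=1}^k\big(f_{t_i-t_{i-1}}(x_i-x_{i-1})\,dx_i\big)\frac{f_{T-t_k}(z-x_k)}{f_T(z)}\,\nu(dz).$$ Generalised Liouville process (GLP). Let $n\ge2$, $m_1,\dots,m_n>0$, $u_0=0$, $u_i=u_{i-1}+m_i$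 (so $u_n=\mathbf{1}\cdot\mathbf{m}$). A process $\{\boldsymbol{\xi}_t\}_{0\le t\le1}$ is an $n$-dimensional GLP with generating law $\nu$ and activity parameter $\mathbf{m}=(m_1,\dots,m_n)^\top$ if it is equal in law to the process with coordinates $L_{tm_i+u_{i-1}}-L_{u_{i-1}}$, $i=1,\dots,n$, $0\le t\le1$, for some LRB $\{L_t\}_{0\le t\le u_n}$ with generating law $\nu$; $f_t$ denotes the marginal densities of the associated Lévy process. It is assumed throughout that $\nu$ has no continuous singular part. For $t\in(0,1)$, $x\in\mathbb{R}$, $B\in\mathcal{B}(\mathbb{R})$, define $$\theta_0(B;x)=\nu(B),\qquad \theta_t(B;x)=\int_B\frac{f_{(\mathbf{1}\cdot\mathbf{m})(1-t)}(z-x)}{f_{\mathbf{1}\cdot\mathbf{m}}(z)}\,\nu(dz),\qquad \Theta_t(x)=\theta_t(\mathbb{R};x).$$ Ratios of densities are understood to be well defined almost surely. *)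

(* Defs.v *)
From mathcomp Require Import all_boot all_order all_algebra.
From mathcomp Require Import all_classical all_reals all_analysis.
From mathcomp Require Import measurable_realfun.

Set Implicit Arguments.
Unset Strict Implicit.
Unset Printing Implicit Defensive.

Import Order.TTheory GRing.Theory Num.Theory.
Import numFieldNormedType.Exports.

Local Open Scope classical_set_scope.
Local Open Scope ring_scope.
Local Open Scope ereal_scope.

(* R^n is [n.-tuple R] with its product sigma-algebra.  The Lebesgue integral
   over R^n is an iterated integral; it is only applied to nonnegative
   measurable integrands, for which the two agree by Tonelli's theorem. *)
Fixpoint lebesgue_int (R : realType) (n : nat) :
    (n.-tuple R -> \bar R) -> \bar R :=
  match n with
  | 0%N => fun g => g [tuple]
  | p.+1 => fun g =>
      \int[@lebesgue_measure R]_x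
        lebesgue_int (fun y : p.-tuple R => g [tuple of x :: y])
  end.

Definition sum_tuple (R : realType) (n : nat) (x : n.-tuple R) : R :=
  (\sum_(i < n) tnth x i)%R.

Definition front_tuple (R : realType) (n : nat) (x : n.+1.-tuple R) :
    n.-tuple R :=
  [tuple tnth x (widen_ord (leqnSn n) i) | i < n].

Definition translate (R : realType) (B : set R) (x : R) : set R :=
  [set y | B (y - x)%R].

Definition is_cprob (R : realType) (d : measure_display)
    (T : measurableType d) (P : probability T R) (G : set (set T))
    (E : set T) (h : T -> \bar R) : Prop :=
  (forall B : set (\bar R), measurable B -> G (h @^-1` B)) /\
  (forall C, G C -> P (E `&` C) = \int[P]_(w in C) h w).

(* [g] is a version of y |-> P(E | Y = y); it is determined only up to a null
   set of the law of Y. *)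
Definition is_cprob_given (R : realType) (d d' : measure_display)
    (T : measurableType d) (S : measurableType d') (P : probability T R)
    (E : set T) (Y : {RV P >-> S}) (g : S -> \bar R) : Prop :=
  measurable_fun setT g /\
  (forall C, measurable C ->
     P (E `&` Y @^-1` C) = \int[distribution P Y]_(y in C) g y).

(* Only the values at times in [0, T] matter; this applies to all the
   processes [R -> {RV P >-> _}] below. *)
Definition cadlag (R : realType) (T : R) (g : R -> R) : Prop :=
  (forall t : R, (0 <= t < T)%R -> g u @[u --> t^'+] --> g t) /\
  (forall t : R, (0 < t <= T)%R -> cvg (g u @[u --> t^'-])).

Definition natural_filtration (R : realType) (d d' : measure_display)
    (T : measurableType d) (S : measurableType d') (P : probability T R)
    (X : R -> {RV P >-> S}) (s : R) : set (set T) :=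
  <<s \bigcup_(u in [set u : R | (0 <= u <= s)%R])
        preimage_set_system setT (X u) measurable >>.

(* P(X_t \in A | F_s) = P(X_t \in A | X_s) almost surely, for the natural
   filtration F: the two sides have a common version. *)
Definition markov_process (R : realType) (d d' : measure_display)
    (T : measurableType d) (S : measurableType d') (P : probability T R)
    (tmax : R) (X : R -> {RV P >-> S}) : Prop :=
  forall s t : R, (0 <= s)%R -> (s <= t)%R -> (t <= tmax)%R ->
  forall A : set S, measurable A ->
  exists h : T -> \bar R,
    is_cprob P (preimage_set_system setT (X s) measurable)
      (X t @^-1` A) h /\
    is_cprob P (natural_filtration X s) (X t @^-1` A) h.

Record levy_process (R : realType) (d : measure_display)
    (T : measurableType d) (P : probability T R) (X : R -> {RV P >-> R}) :
    Prop := {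
  levy_start : {ae P, forall w, X 0%R w = 0%R};
  levy_indep : forall (k : nat) (t : nat -> R) (B : nat -> set R),
    (0 <= t 0%N)%R -> (forall i, (i < k)%N -> (t i <= t i.+1)%R) ->
    (forall i, measurable (B i)) ->
    P [set w | forall i, (i < k)%N -> B i (X (t i.+1) w - X (t i) w)%R] =
    \prod_(i < k) P [set w | B i (X (t i.+1) w - X (t i) w)%R];
  levy_stationary : forall (s h : R) (B : set R),
    (0 <= s)%R -> (0 <= h)%R -> measurable B ->
    P [set w | B (X (s + h)%R w - X s w)%R] = P [set w | B (X h w)];
  levy_cadlag : {ae P, forall w, forall T0 : R,
    cadlag T0 (fun t => X t w)} }.

(* Densities may take the value +oo at some points, as happens for instance
   at the origin for variance gamma processes at small times. *)
Record levy_densities (R : realType) (T : R) (f : R -> R -> \bar R)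
    (d : measure_display) (Om : measurableType d) (P : probability Om R)
    (X : R -> {RV P >-> R}) : Prop := {
  density_measurable : forall t : R, (0 < t <= T)%R ->
    measurable_fun setT (f t);
  density_ge0 : forall t x : R, (0 < t <= T)%R -> 0 <= f t x;
  density_law : forall (t : R) (B : set R), (0 < t <= T)%R -> measurable B ->
    P (X t @^-1` B) = \int[lebesgue_measure]_(x in B) f t x;
  density_convolution : forall s t x : R, (0 < s)%R -> (s < t)%R ->
    (t <= T)%R ->
    f t x = \int[lebesgue_measure]_y (f (t - s)%R (x - y)%R * f s y) }.

(* prod_i f_{t_i - t_{i-1}}(x_i - x_{i-1}) f_{T - t_k}(z - x_k) / f_T(z),
   with t_0 = 0 and x_0 = 0 prepended to the 0-based tuples t and x. *)
Definition bridge_density (R : realType) (T : R) (f : R -> R -> \bar R)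
    (k : nat) (t x : k.-tuple R) (z : R) : \bar R :=
  (\prod_(i < k) f (tnth t i - nth 0 (0 :: t) i)%R
                   (tnth x i - nth 0 (0 :: x) i)%R)
  * f (T - last 0 t)%R (z - last 0 x)%R / f T z.

(* P(X_{t_1} <= x_1, ..., X_{t_k} <= x_k | X_T = z).  Abstract conditional
   probabilities given X_T are defined up to null sets of the law of X_T, which
   the generating law of a bridge may charge (e.g. if it has atoms); so the
   version given by the transition densities has to be used. *)
Definition bridge_cdf (R : realType) (T : R) (f : R -> R -> \bar R)
    (k : nat) (t x : k.-tuple R) (z : R) : \bar R :=
  lebesgue_int (fun y : k.-tuple R =>
    (\1_[set y' : k.-tuple R | forall i, (tnth y' i <= tnth x i)%R] y)%:E
    * bridge_density T f t y z).

(* The Levy process only enters through its law, hence through [f], and may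
   live on another probability space than the bridge. *)
Record levy_random_bridge (R : realType) (T : R) (f : R -> R -> \bar R)
    (nu : probability R R) (d : measure_display) (Om : measurableType d)
    (P : probability Om R) (L : R -> {RV P >-> R}) : Prop := {
  lrb_pos : (0 < T)%R;
  lrb_levy : exists (d' : measure_display) (Om' : measurableType d')
      (P' : probability Om' R) (X : R -> {RV P' >-> R}),
    levy_process X /\ levy_densities T f X;
  lrb_density_pos : {ae nu, forall z, 0 < f T z < +oo};
  lrb_cadlag : {ae P, forall w, cadlag T (fun t => L t w)};
  lrb_terminal : forall B : set R, measurable B -> distribution P (L T) B = nu B;
  lrb_bridge : forall (k : nat) (t x : k.-tuple R), (0 < k)%N ->
    path <%R 0%R (rcons t T) ->
    is_cprob_given [set w | forall i : 'I_k, (L (tnth t i) w <= tnth x i)%R]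
      (L T) (bridge_cdf T f t x) }.

(* u_{i-1} in the 1-based numbering of coordinates. *)
Definition split_time (R : realType) (n : nat) (m : n.-tuple R) (i : 'I_n) : R :=
  (\sum_(j < n | (j < i)%N) tnth m j)%R.

Definition split_process (R : realType) (n : nat) (m : n.-tuple R) (T : Type)
    (L : R -> T -> R) (t : R) (w : T) : n.-tuple R :=
  [tuple (L (t * tnth m i + split_time m i)%R w - L (split_time m i) w)%R
     | i < n].

Definition eq_in_law (R : realType) (tmax : R) (d d1 d2 : measure_display)
    (S : measurableType d)
    (T1 : measurableType d1) (P1 : probability T1 R) (X1 : R -> T1 -> S)
    (T2 : measurableType d2) (P2 : probability T2 R) (X2 : R -> T2 -> S) :
    Prop :=
  forall (k : nat) (t : k.-tuple R) (A : set (k.-tuple S)),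
    (forall j, (0 <= tnth t j <= tmax)%R) -> measurable A ->
    P1 [set w | A [tuple X1 (tnth t j) w | j < k]] =
    P2 [set w | A [tuple X2 (tnth t j) w | j < k]].

Record generalised_liouville_process (R : realType) (n : nat)
    (m : n.-tuple R) (f : R -> R -> \bar R) (nu : probability R R)
    (d : measure_display) (Om : measurableType d) (P : probability Om R)
    (xi : R -> {RV P >-> n.-tuple R}) : Prop := {
  glp_cadlag : {ae P, forall w, forall i,
    cadlag 1 (fun t => tnth (xi t w) i)};
  glp_law : exists (d' : measure_display) (Om' : measurableType d')
      (P' : probability Om' R) (L : R -> {RV P' >-> R}),
    levy_random_bridge (sum_tuple m) f nu L /\
    eq_in_law 1 P (fun t => xi t : Om -> n.-tuple R)
      P' (split_process m (fun t => L t : Om' -> R)) }.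

Definition no_continuous_singular_part (R : realType)
    (nu : probability R R) : Prop :=
  exists nu_ac nu_d : {measure set R -> \bar R},
    [/\ forall B : set R, measurable B -> nu B = nu_ac B + nu_d B,
        nu_ac `<< (@lebesgue_measure R) &
        exists2 D : set R, countable D & nu_d (~` D) = 0].

(* [u] stands for 1.m.  Ratios use the library's total inverse on [\bar R];
   its values at 0 and +oo only matter on null sets. *)
Definition theta (R : realType) (f : R -> R -> \bar R) (nu : probability R R)
    (u t : R) (B : set R) (x : R) : \bar R :=
  if t == 0%R then nu B
  else \int[nu]_(z in B) (f (u * (1 - t))%R (z - x)%R / f u z).

Definition Theta (R : realType) (f : R -> R -> \bar R) (nu : probability R R)
    (u t x : R) : \bar R := theta f nu u t setT x.

(* Main.v *)
From HB Require Import structures.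
Require Import Defs.
From mathcomp Require Import all_boot all_order all_algebra.
From mathcomp Require Import all_classical all_reals all_analysis.
From mathcomp Require Import measurable_realfun.

Set Implicit Arguments.
Unset Strict Implicit.
Unset Printing Implicit Defensive.

Import Order.TTheory GRing.Theory Num.Theory.
Import numFieldNormedType.Exports.

Local Open Scope classical_set_scope.
Local Open Scope ring_scope.
Local Open Scope ereal_scope.

(** Let [L] be the bridge from which [xi] is cut, [X] its Lévy process and
[T = sum_tuple m].  Given [L_T = z], the increments of [L] over a time grid
ending at [t_k < T] are those of [X], reweighted by
[f_(T - t_k) (z - c) / f_T z], where [c] is the sum of the increments.  So the
weight sees the increments only through their sum; everything else about them
is independence.  Visiting the times [u_(i-1) + s_j m_i] block by block
expresses the law of [(xi_(s_0), ..., xi_(s_r), xi_1)] by independent increments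
[v], an independent [z] of law [nu], and that weight ([glp_path_law]).

Fix the past up to time [s].  The increments of the coordinates after [s] are
independent of those before [s], so they can be redrawn without changing the
law ([integral_resample]); after that, the past enters the integral over the
future only through the sums of its increments, that is, through [xi_s].
Therefore the joint law of past and future is a kernel evaluated at [xi_s],
integrated over the past ([terminal_law] for the future time [1],
[transition_law] for [t < 1]).  By the convolution property of the densities
both kernels have total mass [Theta_s (sum_tuple xi_s)]
([terminal_kernel_mass], [transition_kernel_mass]), so this is the density of
the past with respect to independent increments ([history_law]).  Bayes' rule
then gives the quotient of the kernel by [Theta_s] as the conditional
probability given the past.  It is a function of [xi_s], which is the Markov
property, and written with Lebesgue integrals
([terminal_kernelE], [transition_kernelE]) it is the asserted formula.

Three points need care.  The quotients have arbitrary values where the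
denominator is [0] or [+oo]; [posterior_of_ratio] shows that the states where
this happens are null for the law of the process.  The bridge is prescribed
only at times in [(0, T]], whereas the first coordinate of [xi] also uses [L_0];
it vanishes almost surely because the paths are right-continuous and the law
of [L] near time [0] is absolutely continuous with respect to that of [X]
([bridge_starts_at0]).  And the past is the sigma-algebra generated by all
times in [[0, s]]; the cylinders over finite time grids form a pi-system that
generates it ([eq_on_natural_filtration]). *)

(** * Measures with a density along a map *)

Lemma integral_indicM d (T : measurableType d) (R : realType)
    (mu : {measure set T -> \bar R}) (A : set T) (f : T -> \bar R) :
  \int[mu]_(x in A) f x = \int[mu]_x ((\1_A x)%:E * f x).
Proof.
rewrite integral_mkcond; apply: eq_integral => x _.
rewrite patchE indicE; case: ifPn => _; first by rewrite mul1e.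
by rewrite mul0e.
Qed.

Lemma indic_ge0 (R : realType) (T : Type) (A : set T) x :
  0 <= (\1_A x : R)%:E.
Proof. by rewrite lee_fin indicE. Qed.
#[local] Hint Resolve indic_ge0 : core.

Lemma emeasurable_indic d (T : measurableType d) (R : realType) (A : set T) :
  measurable A -> measurable_fun setT (fun x => (\1_A x : R)%:E).
Proof. by move=> mA; apply/measurable_EFinP; exact: measurable_indic. Qed.

Section weighted_law.
Context d d' (T : measurableType d) (S : measurableType d') (R : realType).
Variables (mu : {measure set T -> \bar R}) (H : T -> S) (w : T -> \bar R).
Hypotheses (mH : measurable_fun setT H) (mw : measurable_fun setT w)
  (w0 : forall x, 0 <= w x).

(** The law of [H] under the measure with density [w] with respect to [mu].
The hypotheses on [H] and [w] are arguments so that the measure structure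
can be inferred from the term. *)
Definition weighted_law of measurable_fun setT H & measurable_fun setT w &
    (forall x, 0 <= w x) := fun A : set S => \int[mu]_(x in H @^-1` A) w x.

Let wl := weighted_law mH mw w0.

Let wl0 : wl set0 = 0.
Proof. by rewrite /wl /weighted_law preimage_set0 integral_set0. Qed.

Let wl_ge0 A : 0 <= wl A.
Proof. by apply: integral_ge0 => x _; exact: w0. Qed.

Let mHA A : measurable A -> measurable (H @^-1` A).
Proof. by move=> mA; rewrite -[X in measurable X]setTI; exact: mH. Qed.

Let wl_sigma_additive : semi_sigma_additive wl.
Proof.
move=> F mF tF mUF.
rewrite /wl /weighted_law preimage_bigcup ge0_integral_bigcup//.
- apply: is_cvg_ereal_nneg_natsum_cond => n _ _.
  by apply: integral_ge0 => x _; exact: w0.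
- by move=> k; exact: mHA.
- exact: measurable_funS mw.
- move=> i j _ _ [x [/= Fi Fj]]; apply: (tF i j) => //.
  by exists (H x).
Qed.

HB.instance Definition _ := isMeasure.Build _ _ _ (weighted_law mH mw w0)
  wl0 wl_ge0 wl_sigma_additive.

Import HBNNSimple.

(** True for indicators by definition, hence for simple functions, hence for
all nonnegative functions by monotone convergence.  Where [w] is infinite the
product is not continuous in its first factor at [0]; there the limit is
computed by hand. *)
Lemma integral_weighted_law (phi : S -> \bar R) :
  measurable_fun setT phi -> (forall y, 0 <= phi y) ->
  \int[weighted_law mH mw w0]_y phi y = \int[mu]_x (phi (H x) * w x).
Proof.
move=> mphi phi0; pose f_ := nnsfun_approx measurableT mphi.
have mfn n : measurable_fun setT (fun x => (f_ n x)%:E).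
  exact/measurable_EFinP/measurable_funP.
transitivity (limn (fun n => \int[weighted_law mH mw w0]_x (f_ n x)%:E)).
  rewrite -monotone_convergence//.
  - apply: eq_integral => y _; apply/esym/cvg_lim => //.
    exact: cvg_nnsfun_approx.
  - by move=> n y _; rewrite lee_fin.
  - by move=> y _ m n mn; rewrite lee_fin; exact/lefP/nd_nnsfun_approx.
transitivity (limn (fun n => \int[mu]_x ((f_ n (H x))%:E * w x))); last first.
  rewrite -monotone_convergence//; last 3 first.
  - move=> n; apply: emeasurable_funM => //.
    exact: (measurableT_comp (mfn n) mH).
  - by move=> n x _; rewrite mule_ge0// lee_fin.
  - move=> x _ m n mn; apply: lee_wpmul2r => //.
    by rewrite lee_fin; exact/lefP/nd_nnsfun_approx.
  apply: eq_integral => x _; apply/cvg_lim => //.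
  have fx : (f_ n (H x))%:E @[n --> \oo] --> phi (H x).
    exact: cvg_nnsfun_approx.
  have [wx|] := boolP (w x \is a fin_num); first exact: cvgeZr.
  rewrite ge0_fin_numE// -leNgt leye_eq => /eqP wy.
  have [p0|p0] := eqVneq (phi (H x)) 0.
    rewrite p0 mul0e.
    rewrite (_ : (fun n => _) = cst 0); first exact: cvg_cst.
    apply/funext => n /=; suff -> : f_ n (H x) = 0%R by rewrite mul0e.
    apply/eqP; rewrite eq_le; apply/andP; split; last by [].
    rewrite -lee_fin -[leRHS]p0; apply: (cvge_ge _ fx).
    exists n => // k /= nk; rewrite lee_fin.
    exact/lefP/nd_nnsfun_approx.
  have p1 : 0 < phi (H x) by rewrite lt0e p0 phi0.
  rewrite wy gt0_muley//; apply: cvg_near_cst.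
  have [N HN] : exists N, 0 < (f_ N (H x))%:E.
    apply: contrapT => fN; move: p1; rewrite ltNge => /negP; apply.
    apply: (cvge_le _ fx); near=> n; rewrite leNgt; apply/negP => fn0.
    by apply: fN; exists n.
  exists N => // n /= Nn; rewrite gt0_muley// (lt_le_trans HN)// lee_fin.
  exact/lefP/nd_nnsfun_approx.
congr (limn _); apply/funext => n.
under [LHS]eq_integral do rewrite fimfunE -fsumEFin//.
rewrite ge0_integral_fsum//; last 2 first.
- by move=> r; exact/measurable_EFinP/measurable_funM.
- by move=> r y _; rewrite nnfun_muleindic_ge0.
have fE x : (f_ n (H x))%:E * w x = \sum_(r \in range (f_ n))
    ((r * \1_(f_ n @^-1` [set r]) (H x))%:E * w x).
  rewrite fimfunE -fsumEFin// ge0_mule_fsuml// => r.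
  by rewrite nnfun_muleindic_ge0.
under [RHS]eq_integral do rewrite fE.
rewrite ge0_integral_fsum//; last 2 first.
- move=> r; apply: emeasurable_funM => //.
  have mr : measurable_fun setT (fun y => (r * \1_(f_ n @^-1` [set r]) y)%:E).
    exact/measurable_EFinP/measurable_funM.
  exact: (measurableT_comp mr mH).
- by move=> r y _; rewrite mule_ge0// nnfun_muleindic_ge0.
apply: eq_fsbigr => r rf.
rewrite integralZl_indic_nnsfun// integral_indic// setIT.
under [RHS]eq_integral do rewrite EFinM -muleA.
have r0 : (0 <= r)%R by move: rf; rewrite inE => -[y _ <-].
rewrite ge0_integralZl_EFin//.
- by congr (_ * _); exact: integral_indicM.
- by move=> x _; rewrite mule_ge0.
- apply: emeasurable_funM => //.
  have mr : measurable_fun setT (fun y => (\1_(f_ n @^-1` [set r]) y : R)%:E).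
    exact: emeasurable_indic.
  exact: (measurableT_comp mr mH).
Unshelve. all: by end_near. Qed.

End weighted_law.

(** * Product laws and iterated Lebesgue integrals *)

Section measurability.
Context d (T : measurableType d) (R : realType).

Lemma measurable_inve (f : T -> \bar R) : measurable_fun setT f ->
  (forall x, 0 <= f x) -> measurable_fun setT (fun x => (f x)^-1).
Proof.
move=> mf f0.
have -> : (fun x => (f x)^-1) =
    (fun x => if f x == 0 then +oo else (powR (fine (f x)) (-1))%:E).
  apply/funext => x; case: eqP => [->|/eqP fx0]; first by rewrite inve0.
  case: (f x) (f0 x) fx0 => [r r0 rn0|_ _|//].
    by rewrite eqe in rn0; rewrite inver (negbTE rn0) powR_inv1.
  by rewrite invey /= powR0// oppr_eq0 oner_neq0.
apply: measurable_fun_ifT.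
- apply: (measurable_fun_bool true).
  rewrite (_ : _ @^-1` _ = f @^-1` [set 0]); last first.
    by apply/seteqP; split=> x /= /eqP.
  by have := mf measurableT _ (emeasurable_set1 0); rewrite setTI.
- exact: measurable_cst.
- apply/measurable_EFinP.
  have mfine : measurable_fun setT (fine \o f).
    exact: (measurableT_comp (@fine_measurable R setT measurableT)).
  exact: (measurableT_comp (@measurable_powR R (-1)) mfine).
Qed.

End measurability.

Section lebesgue_shift.
Context (R : realType).
Local Notation leb := (@lebesgue_measure R).

Let measurable_shift (a : R) :
  measurable_fun setT ((fun x => x + a)%R : measurableTypeR R -> measurableTypeR R).
Proof. by apply: measurable_funD => //; exact: measurable_cst. Qed.

Lemma lebesgue_measure_shift (a : R) (A : set R) : measurable A ->
  pushforward leb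
    ((fun x => x + a)%R : measurableTypeR R -> measurableTypeR R) A = leb A.
Proof.
move=> mA; apply/esym/lebesgue_measure_unique => //=.
move=> _ [[x y]] _ <-.
rewrite /pushforward (_ : _ @^-1` _ = `](x - a)%R, (y - a)%R]%classic); last first.
  by apply/seteqP; split=> z /=; rewrite !in_itv/= ltrBlDr lerBrDr.
rewrite !lebesgue_measure_itv/= !lte_fin ltrD2r.
by case: ifPn => // _; rewrite -!EFinD; congr _%:E; rewrite opprB addrA subrK.
Qed.

Lemma ge0_integral_shift (a : R) (F : R -> \bar R) :
  measurable_fun setT F -> (forall x, 0 <= F x) ->
  \int[leb]_x F (x + a)%R = \int[leb]_x F x.
Proof.
move=> mF F0.
transitivity (\int[pushforward leb
    ((fun x => x + a)%R : measurableTypeR R -> measurableTypeR R)]_x F x).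
  by rewrite (ge0_integral_pushforward (measurable_shift a)).
by apply: eq_measure_integral => /= A mA _; exact: lebesgue_measure_shift.
Qed.

End lebesgue_shift.

Definition has_density (R : realType) (mu : {measure set R -> \bar R})
    (h : R -> \bar R) :=
  [/\ measurable_fun setT h, forall x, 0 <= h x &
     forall B, measurable B -> mu B = \int[lebesgue_measure]_(x in B) h x].

Lemma integral_density_shift (R : realType) (mu : {measure set R -> \bar R})
    (h G : R -> \bar R) (a : R) :
  has_density mu h -> measurable_fun setT G -> (forall x, 0 <= G x) ->
  \int[lebesgue_measure]_y (G y * h (y - a)%R) = \int[mu]_v G (a + v)%R.
Proof.
move=> [mh h0 muE] mG G0.
have mGa : measurable_fun setT (fun v : R => G (a + v)%R).
  have ma : measurable_fun setT (fun v : R => a + v)%R.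
    by apply: measurable_funD => //; exact: measurable_cst.
  exact: (measurableT_comp mG ma).
have mha : measurable_fun setT (fun v : R => h (v - a)%R).
  have ma : measurable_fun setT (fun v : R => v - a)%R.
    by apply: measurable_funD => //; exact: measurable_cst.
  exact: (measurableT_comp mh ma).
rewrite -(@ge0_integral_shift _ a); last 2 first.
- exact: emeasurable_funM.
- by move=> x; rewrite mule_ge0.
have mid : measurable_fun setT (id : measurableTypeR R -> R) by [].
transitivity (\int[weighted_law lebesgue_measure mid mh h0]_v G (a + v)%R).
  rewrite integral_weighted_law//.
  by apply: eq_integral => x _; rewrite addrK addrC.
by apply: eq_measure_integral => /= A mA _; rewrite muE.
Qed.

Lemma measurable_rect d (T : measurableType d) n (E : 'I_n -> set T) :
  (forall i, measurable (E i)) ->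
  measurable [set v : n.-tuple T | forall i, E i (tnth v i)].
Proof.
move=> mE.
have -> : [set v : n.-tuple T | forall i, E i (tnth v i)] =
    \bigcap_(i in [set: 'I_n]) ((fun v => tnth v i) @^-1` E i).
  apply/seteqP; split=> [v /= H i _|v /= H i]; first exact: H.
  exact: (H i I).
apply: fin_bigcap_measurable => // i _.
by have := measurable_tnth i measurableT (mE i); rewrite setTI.
Qed.

Section tuple_product.
Context (R : realType).

Definition tcons n (x : R * n.-tuple R) : n.+1.-tuple R := [tuple of x.1 :: x.2].

Lemma measurable_tcons n : measurable_fun setT (@tcons n).
Proof. exact: measurable_cons. Qed.

HB.instance Definition _ n := isMeasurableFun.Build _ _ _ _ (@tcons n)
  (@measurable_tcons n).

(** The law of [n] independent variables, the [i]-th of law [mu i].  The laws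
are indexed by [nat], so that the recursion needs no casts on ordinals. *)
Fixpoint tprod n (mu : nat -> probability R R) : probability (n.-tuple R) R :=
  match n with
  | 0%N => dirac ([tuple] : 0.-tuple R)
  | p.+1 => distribution (mu 0%N \x tprod p (fun i => mu i.+1)) (@tcons p)
  end.

Lemma integral_tprod0 mu (phi : 0.-tuple R -> \bar R) :
  measurable_fun setT phi ->
  \int[tprod 0 mu]_v phi v = phi [tuple].
Proof. by move=> mphi; rewrite integral_dirac//= diracT mul1e. Qed.

Lemma integral_tprodS n mu (phi : n.+1.-tuple R -> \bar R) :
  measurable_fun setT phi -> (forall v, 0 <= phi v) ->
  \int[tprod n.+1 mu]_v phi v =
  \int[mu 0%N]_x \int[tprod n (fun i => mu i.+1)]_v phi [tuple of x :: v].
Proof.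
move=> mphi phi0; rewrite ge0_integral_distribution//.
rewrite fubini_tonelli1//.
  exact: (measurableT_comp mphi (@measurable_tcons n)).
by move=> x; exact: phi0.
Qed.

Lemma tprod_rect n (mu : nat -> probability R R) (E : nat -> set R) :
  (forall i, measurable (E i)) ->
  tprod n mu [set v | forall i : 'I_n, E i (tnth v i)] =
  \prod_(i < n) mu i (E i).
Proof.
elim: n mu E => [|n IH] mu E mE.
  rewrite big_ord0 /= diracE mem_set//= => -[] //.
rewrite big_ord_recl -(IH (fun i => mu i.+1) (fun i => E i.+1))//.
rewrite /= /distribution /pushforward -product_measure1E//.
  congr (_ _); apply/seteqP; split=> [[x v]/= H|[x v] /= [Ex Ev] i].
    split; first exact: (H ord0).
    by move=> i; have := H (lift ord0 i); rewrite /tcons/= tnthS.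
  by case: (unliftP ord0 i) => [j ->|-> //]; rewrite /tcons/= tnthS; exact: Ev.
by apply: (@measurable_rect _ R n (fun i => E i.+1)) => i; exact: mE.
Qed.

End tuple_product.
Arguments tprod : simpl never.

(** * Sums of independent increments *)

Section sequential_densities.
Context (R : realType).

Definition psum n (v : n.-tuple R) (l : nat) : R :=
  (\sum_(i < n | (i < l)%N) tnth v i)%R.

Lemma psum0 n (v : n.-tuple R) : psum v 0 = 0%R.
Proof. by rewrite /psum big_pred0. Qed.

Lemma psum_cons n a (v : n.-tuple R) l :
  psum [tuple of a :: v] l.+1 = (a + psum v l)%R.
Proof.
rewrite /psum big_mkcond big_ord_recl/= [in RHS]big_mkcond/=; congr (_ + _)%R.
by apply: eq_bigr => i _; rewrite tnthS.
Qed.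

Lemma psum_full n (v : n.-tuple R) l : (n <= l)%N -> psum v l = sum_tuple v.
Proof.
move=> nl; rewrite /psum /sum_tuple; apply: eq_bigl => i.
by rewrite (leq_trans _ nl).
Qed.

Lemma measurable_psum n l : measurable_fun setT (@psum n ^~ l).
Proof.
rewrite /psum; under eq_fun do rewrite big_mkcond.
apply: measurable_sum => i; case: (i < l)%N; first exact: measurable_tnth.
exact: measurable_cst.
Qed.

Definition walk (x0 : R) n (v : n.-tuple R) : n.-tuple R :=
  [tuple (x0 + psum v i.+1)%R | i < n].

Lemma walk_cons x0 a n (v : n.-tuple R) :
  walk x0 [tuple of a :: v] = [tuple of (x0 + a)%R :: walk (x0 + a)%R v].
Proof.
apply: eq_from_tnth => i; rewrite tnth_mktuple psum_cons.
case: (unliftP ord0 i) => [j ->|->]; first by rewrite tnthS tnth_mktuple addrA.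
by rewrite psum0 addr0.
Qed.

Lemma measurable_walk n :
  measurable_fun setT (fun p : R * n.-tuple R => walk p.1 p.2).
Proof.
apply/measurable_fun_tnthP => i; rewrite /comp.
under eq_fun do rewrite tnth_mktuple.
apply: measurable_funD => //.
exact: (measurableT_comp (@measurable_psum n i.+1) measurable_snd).
Qed.

(** The substitution [v_i = y_i - y_(i-1)], with [y_(-1) = x0], turns a product
of densities of increments into a product law.  In the induction the first
point of the walk becomes the starting point of the others. *)
Lemma lebesgue_int_walk n (mu : nat -> probability R R)
    (h : nat -> R -> \bar R) x0 (psi : n.-tuple R -> \bar R) :
  (forall i, (i < n)%N -> has_density (mu i) (h i)) ->
  measurable_fun setT psi -> (forall y, 0 <= psi y) ->
  lebesgue_int (fun y => psi y *
    \prod_(i < n) h i (tnth y i - nth 0 (x0 :: y) i)%R) =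
  \int[tprod n mu]_v psi (walk x0 v).
Proof.
elim: n mu h x0 psi => [|n IH] mu h x0 psi hd mpsi psi0.
  rewrite integral_tprod0; last first.
    exact: (measurableT_comp mpsi
      (measurableT_comp (@measurable_walk 0) (pair1_measurable _))).
  by rewrite /= big_ord0 mule1; congr psi; rewrite [RHS]tuple0.
have mw : measurable_fun setT (fun p : R * n.-tuple R =>
    psi [tuple of p.1 :: walk p.1 p.2]).
  exact: (measurableT_comp mpsi (measurable_cons measurable_fst (@measurable_walk n))).
pose G x := \int[tprod n (fun i => mu i.+1)]_v psi [tuple of x :: walk x v].
have mG : measurable_fun setT G.
  exact: (@measurable_fun_fubini_tonelli_F _ _ _ _ _
    (tprod n (fun i => mu i.+1)) _ mw (fun p => psi0 _)).
have G0 x : 0 <= G x by apply: integral_ge0.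
have [mh h0 _] := hd 0%N isT.
have -> : lebesgue_int (fun y : n.+1.-tuple R => psi y *
      \prod_(i < n.+1) h i (tnth y i - nth 0 (x0 :: y) i)%R) =
    \int[lebesgue_measure]_x (G x * h 0%N (x - x0)%R).
  apply: eq_integral => x _.
  rewrite /G -ge0_integralZr//; last first.
    exact: (measurableT_comp mw (pair1_measurable _)).
  rewrite -(IH _ (fun i => h i.+1) x (fun y => psi [tuple of x :: y] * h 0%N (x - x0)%R)).
  - congr lebesgue_int; apply/funext => y.
    rewrite big_ord_recl/= muleA; congr (_ * _).
    by apply: eq_bigr => i _; rewrite tnthS.
  - by move=> i ni; exact: hd.
  - apply: emeasurable_funM; last exact: measurable_cst.
    by apply: (measurableT_comp mpsi); apply: measurable_cons.
  - by move=> y; rewrite mule_ge0.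
rewrite (integral_density_shift _ (hd 0%N isT))//.
rewrite integral_tprodS//; last first.
  exact: (measurableT_comp mpsi
      (measurableT_comp (@measurable_walk n.+1) (pair1_measurable _))).
apply: eq_integral => x _; apply: eq_integral => v _.
by rewrite walk_cons.
Qed.

Definition tadd n (x y : n.-tuple R) : n.-tuple R :=
  [tuple (tnth x i + tnth y i)%R | i < n].

Lemma tadd_cons n a b (x y : n.-tuple R) :
  tadd [tuple of a :: x] [tuple of b :: y] = [tuple of (a + b)%R :: tadd x y].
Proof.
apply: eq_from_tnth => i; rewrite tnth_mktuple.
by case: (unliftP ord0 i) => [j ->|-> //]; rewrite !tnthS tnth_mktuple.
Qed.

Lemma measurable_tadd n :
  measurable_fun setT (fun p : n.-tuple R * n.-tuple R => tadd p.1 p.2).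
Proof.
apply/measurable_fun_tnthP => i; rewrite /comp.
under eq_fun do rewrite tnth_mktuple.
apply: measurable_funD.
  exact: (measurableT_comp (measurable_tnth i) measurable_fst).
exact: (measurableT_comp (measurable_tnth i) measurable_snd).
Qed.

(** The same for increments that all start from the given point [x]: this is
the form in which the transition densities of the theorem appear. *)
Lemma lebesgue_int_tadd n (mu : nat -> probability R R)
    (h : nat -> R -> \bar R) (x : n.-tuple R) (psi : n.-tuple R -> \bar R) :
  (forall i, (i < n)%N -> has_density (mu i) (h i)) ->
  measurable_fun setT psi -> (forall y, 0 <= psi y) ->
  lebesgue_int (fun y => psi y *
    \prod_(i < n) h i (tnth y i - tnth x i)%R) =
  \int[tprod n mu]_v psi (tadd x v).
Proof.
elim: n mu h x psi => [|n IH] mu h x psi hd mpsi psi0.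
  rewrite integral_tprod0; last first.
    exact: (measurableT_comp mpsi
      (measurableT_comp (@measurable_tadd 0) (pair1_measurable _))).
  by rewrite /= big_ord0 mule1; congr psi; rewrite [RHS]tuple0.
case/tupleP: x => x0 x.
have mw : measurable_fun setT (fun p : R * n.-tuple R =>
    psi [tuple of p.1 :: tadd x p.2]).
  apply: (measurableT_comp mpsi); apply: measurable_cons => //.
  exact: (measurableT_comp (@measurable_tadd n)
    (measurableT_comp (pair1_measurable x) measurable_snd)).
pose G y := \int[tprod n (fun i => mu i.+1)]_v psi [tuple of y :: tadd x v].
have mG : measurable_fun setT G.
  exact: (@measurable_fun_fubini_tonelli_F _ _ _ _ _
    (tprod n (fun i => mu i.+1)) _ mw (fun p => psi0 _)).
have G0 y : 0 <= G y by apply: integral_ge0.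
have [mh h0 _] := hd 0%N isT.
have -> : lebesgue_int (fun y : n.+1.-tuple R => psi y *
      \prod_(i < n.+1) h i (tnth y i - tnth [tuple of x0 :: x] i)%R) =
    \int[lebesgue_measure]_y (G y * h 0%N (y - x0)%R).
  apply: eq_integral => y _.
  rewrite /G -ge0_integralZr//; last first.
    exact: (measurableT_comp mw (pair1_measurable _)).
  rewrite -(IH _ (fun i => h i.+1) x (fun z => psi [tuple of y :: z] * h 0%N (y - x0)%R)).
  - congr lebesgue_int; apply/funext => z.
    rewrite big_ord_recl/= muleA; congr (_ * _).
    by apply: eq_bigr => i _; rewrite !tnthS.
  - by move=> i ni; exact: hd.
  - apply: emeasurable_funM; last exact: measurable_cst.
    by apply: (measurableT_comp mpsi); apply: measurable_cons.
  - by move=> z; rewrite mule_ge0.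
rewrite (integral_density_shift _ (hd 0%N isT))//.
rewrite integral_tprodS//; last first.
  exact: (measurableT_comp mpsi
      (measurableT_comp (@measurable_tadd n.+1) (pair1_measurable _))).
apply: eq_integral => y _; apply: eq_integral => v _.
by rewrite tadd_cons.
Qed.

End sequential_densities.

(** * Finite measures determined by orthants *)

Section orthants.
Context d (S : measurableType d) (R : realType) (n : nat).

Definition orthant (x : n.-tuple R) : set (n.-tuple R) :=
  [set y | forall i, (tnth y i <= tnth x i)%R].

Lemma measurable_orthant x : measurable (orthant x).
Proof.
apply: (@measurable_rect _ R n (fun i => `]-oo, tnth x i]%classic)) => i.
exact: measurable_itv.
Qed.

Let G : set (set (n.-tuple R * S)) :=
  [set C | exists x B, measurable B /\ C = orthant x `*` B].

Let orthantI x y : orthant x `&` orthant y =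
  orthant [tuple Num.min (tnth x i) (tnth y i) | i < n].
Proof.
apply/seteqP; split=> z /=.
  by move=> [zx zy] i; rewrite tnth_mktuple le_min zx zy.
by move=> H; split=> i; have := H i; rewrite tnth_mktuple le_min => /andP[].
Qed.

Let cst_orthant (k : nat) := orthant [tuple k%:R | i < n].

Let cst_orthantP (y : n.-tuple R) : exists k, cst_orthant k y.
Proof.
exists (Num.truncn (\sum_(i < n) `|tnth y i|)%R).+1 => i; rewrite tnth_mktuple.
apply/ltW/(le_lt_trans _ (Num.Theory.truncnS_gt _)).
rewrite (bigD1 i)//= (le_trans (ler_norm _))// lerDl.
by apply: sumr_ge0 => j _.
Qed.

(* A half-line in one coordinate is the complement of a countable union of
   orthants whose other bounds increase to infinity. *)
Let measurableE : @measurable _ (n.-tuple R * S)%type = <<s G >>.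
Proof.
apply/seteqP; split; last first.
  apply: smallest_sub; first exact: sigma_algebra_measurable.
  by move=> _ [x [B [mB ->]]]; apply: measurableX => //; exact: measurable_orthant.
pose T' := g_sigma_algebraType G.
suff mid : measurable_fun setT (id : T' -> (n.-tuple R * S)%type).
  by move=> A mA; have := mid measurableT A mA; rewrite setTI.
apply/measurable_fun_pairP; split.
  apply/measurable_fun_tnthP => i.
  apply: (@measurability _ _ T' R setT _ (@RGenOInfty.G R)).
    exact: RGenOInfty.measurableE.
  move=> _ [_ [a ->] <-]; rewrite setTI.
  rewrite (_ : _ @^-1` _ = ~` \bigcup_k (orthant
      [tuple if j == i then a else k%:R | j < n] `*` setT)); last first.
    apply/seteqP; split=> [[y s]/=|[y s]/= H].
      rewrite in_itv/= andbT => ay [k _ [/= /(_ i)]].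
      by rewrite tnth_mktuple eqxx leNgt ay.
    rewrite in_itv/= andbT ltNge; apply/negP => ya; apply: H.
    have [k yk] := cst_orthantP y; exists k => //; split => //= j.
    rewrite tnth_mktuple; case: eqP => [->//|_].
    by have := yk j; rewrite tnth_mktuple.
  apply: measurableC; apply: bigcupT_measurable => k.
  apply: sub_sigma_algebra; exists [tuple if j == i then a else k%:R | j < n].
  by exists setT; split.
move=> _ B mB; rewrite setTI.
rewrite (_ : _ @^-1` _ = \bigcup_k (cst_orthant k `*` B)); last first.
  apply/seteqP; split=> [[y s]/= Bs|[y s]/= [k _ [_ //]]].
  by have [k yk] := cst_orthantP y; exists k.
apply: bigcupT_measurable => k.
apply: sub_sigma_algebra; exists [tuple k%:R | i < n].
by exists B; split.
Qed.

(** The defining property of a bridge speaks of distribution functions of the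
intermediate values, jointly with an arbitrary event for the terminal value;
by this lemma such data determine a finite measure. *)
Lemma eq_measure_orthant (m1 m2 : {measure set (n.-tuple R * S) -> \bar R}) :
  m1 setT < +oo ->
  (forall x B, measurable B -> m1 (orthant x `*` B) = m2 (orthant x `*` B)) ->
  forall A, measurable A -> m1 A = m2 A.
Proof.
move=> m1T m12; apply: (measure_unique G (fun k => cst_orthant k `*` setT)).
- exact: measurableE.
- move=> _ _ [x [B [mB ->]]] [y [C [mC ->]]]; rewrite -setXI orthantI.
  exists [tuple Num.min (tnth x i) (tnth y i) | i < n].
  by exists (B `&` C); split=> //; exact: measurableI.
- by move=> k; exists [tuple k%:R | i < n], setT; split.
- apply/seteqP; split=> // -[y s] _.
  by have [k yk] := cst_orthantP y; exists k.
- by move=> _ [x [B [mB ->]]]; exact: m12.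
- move=> k; apply: le_lt_trans m1T; apply: le_measure => //; rewrite inE//.
  by apply: measurableX => //; exact: measurable_orthant.
Qed.

End orthants.

Lemma eq_tuple_measure_orthant (R : realType) n
    (m1 m2 : {measure set (n.-tuple R) -> \bar R}) :
  m1 setT < +oo -> (forall x, m1 (orthant x) = m2 (orthant x)) ->
  forall A, measurable A -> m1 A = m2 A.
Proof.
move=> m1T m12 A mA; pose g (x : n.-tuple R) := (x, tt).
have mg : measurable_fun setT g.
  by apply: measurable_fun_pair; [exact: measurable_id|exact: measurable_cst].
have gAE : g @^-1` (A `*` setT) = A by apply/seteqP; split=> y //= [].
rewrite -gAE; change (pushforward m1 g (A `*` setT) = pushforward m2 g (A `*` setT)).
apply: eq_measure_orthant => [|x B mB|]; first by [].
- change (m1 (g @^-1` (orthant x `*` B)) = m2 (g @^-1` (orthant x `*` B))).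
  have [Bt|Bt] := pselect (B tt).
    rewrite (_ : g @^-1` _ = orthant x)//.
    by apply/seteqP; split=> y //= [].
  rewrite (_ : g @^-1` _ = set0) ?measure0//.
  by apply/seteqP; split=> y //= [].
- exact: measurableX.
Qed.

(** * Resampling independent coordinates *)

Section resampling.
Context (R : realType).

Definition resample n q (b : nat -> nat) (x : n.-tuple R) (y : q.-tuple R) :
    n.-tuple R :=
  [tuple if [pick j : 'I_q | b j == i] is Some j then tnth y j else tnth x i
     | i < n].

Lemma measurable_resample n q b :
  measurable_fun setT (fun p : n.-tuple R * q.-tuple R => resample b p.1 p.2).
Proof.
apply/measurable_fun_tnthP => i; rewrite /comp.
under eq_fun do rewrite tnth_mktuple.
case: pickP => [j _|_].
  exact: (measurableT_comp (measurable_tnth j) measurable_snd).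
exact: (measurableT_comp (measurable_tnth i) measurable_fst).
Qed.

(** Replacing coordinates of a vector of independent variables by independent
copies does not change its law.  This is how the increments after the present
time are separated from those before it, without having to reorder them. *)
Lemma integral_resample n q (b : nat -> nat) (mu : nat -> probability R R)
    (phi : n.-tuple R -> \bar R) :
  (forall j, (j < q)%N -> (b j < n)%N) ->
  (forall i j, (i < q)%N -> (j < q)%N -> b i = b j -> i = j) ->
  measurable_fun setT phi -> (forall v, 0 <= phi v) ->
  \int[tprod n mu]_x phi x =
  \int[tprod n mu]_x \int[tprod q (mu \o b)]_y phi (resample b x y).
Proof.
move=> bn binj mphi phi0.
pose f (p : n.-tuple R * q.-tuple R) := resample b p.1 p.2.
have mf : measurable_fun setT f by exact: measurable_resample.
transitivity (\int[pushforward (tprod n mu \x tprod q (mu \o b)) f]_x phi x);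
    last first.
  rewrite (ge0_integral_pushforward mf)// fubini_tonelli1//.
    exact: (measurableT_comp mphi mf).
  by move=> p; exact: phi0.
apply: eq_measure_integral => A mA _.
apply: eq_tuple_measure_orthant mA => [|x].
  by change (tprod n mu setT < +oo); rewrite probability_setT; exact: ltry.
pose E (i : nat) : set R := `]-oo, (nth 0 x i)%R]%classic.
have mE i : measurable (E i) by exact: measurable_itv.
(* [D i] holds when the coordinate [i] is redrawn; then the old value is
   unconstrained and the constraint moves to the copy. *)
pose D (i : nat) := [exists j : 'I_q, b j == i].
pose E1 (i : nat) : set R := if D i then setT else E i.
have mE1 i : measurable (E1 i) by rewrite /E1; case: ifP.
have orthE : orthant x = [set v | forall i : 'I_n, E i (tnth v i)].
  apply/seteqP; split=> v /= H i; have := H i.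
    by rewrite /E/= in_itv/= -tnth_nth.
  by rewrite /E/= in_itv/= -tnth_nth.
change (tprod n mu (orthant x) =
  (tprod n mu \x tprod q (mu \o b)) (f @^-1` (orthant x))).
have -> : f @^-1` (orthant x) =
    [set v : n.-tuple R | forall i : 'I_n, E1 i (tnth v i)] `*`
    [set w : q.-tuple R | forall j : 'I_q, E (b j) (tnth w j)].
  rewrite orthE; apply/seteqP; split=> [[v w] /= H|[v w] /= [H1 H2]].
    split=> [i|j].
      rewrite /E1; case: ifPn => // /existsPn Di.
      have := H i; rewrite tnth_mktuple; case: pickP => // j bj.
      by have := Di j; rewrite bj.
    have := H (Ordinal (bn j (ltn_ord j))); rewrite tnth_mktuple /=.
    case: pickP => [k /eqP /(binj _ _ (ltn_ord k) (ltn_ord j)) kj|/(_ j)].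
      by have -> : k = j by exact: val_inj.
    by rewrite eqxx.
  move=> i; rewrite tnth_mktuple; case: pickP => [j /eqP <-|Di].
    exact: H2.
  have := H1 i; rewrite /E1; case: ifPn => // /existsP[j bj].
  by have := Di j; rewrite bj.
transitivity ((\prod_(i < n) mu i (E1 i)) * \prod_(j < q) mu (b j) (E (b j)));
    last first.
  rewrite -(@tprod_rect R n mu E1 mE1) -(@tprod_rect R q (mu \o b) (fun j => E (b j)))//.
  apply/esym/product_measure1E; first exact: (@measurable_rect _ R n (fun i => E1 i)).
  exact: (@measurable_rect _ R q (fun j => E (b j))).
rewrite orthE tprod_rect//.
rewrite [LHS](bigID (fun i : 'I_n => D i))/= muleC; congr (_ * _).
  rewrite [RHS](bigID (fun i : 'I_n => D i))/= [X in _ = X * _]big1 ?mul1e.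
    by apply: eq_bigr => i Di; rewrite /E1 (negbTE Di).
  by move=> i Di; rewrite /E1 Di probability_setT.
pose bo (j : 'I_q) := Ordinal (bn j (ltn_ord j)).
have boinj : injective bo.
  by move=> j k /(congr1 val) /= /(binj _ _ (ltn_ord j) (ltn_ord k)) /val_inj.
rewrite (eq_bigl (fun i => i \in bo @: 'I_q)); last first.
  move=> i; apply/existsP/imsetP => [[j /eqP bj]|[j _ ->]]; last by exists j => /=.
  by exists j => //; apply: val_inj; rewrite /= bj.
rewrite big_imset/=; last by move=> ? ? _ _; exact: boinj.
by [].
Qed.

End resampling.

(** * Bayes' rule *)

Section bayes.
Context d d' d'' (T : measurableType d) (T' : measurableType d')
  (S : measurableType d'') (R : realType).

(** If [N] is the density of the observation [h] with respect to a reference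
law and [K] that of [h] on the event [E], then [K / N] is the conditional
probability of [E] given [h].  The value of [g] is constrained only where [N] is
neither [0] nor [+oo].  This is enough: [N] has integral [1], so it is almost
surely finite, and [E] being part of the whole space forces [K] to vanish almost
everywhere on the set where [N] does. *)
Lemma posterior_of_ratio (P : probability T R) (Q : probability T' R)
    (h : T -> S) (H : T' -> S) (E : set T) (K N g : S -> \bar R) :
  measurable_fun setT h -> measurable_fun setT H -> measurable E ->
  measurable_fun setT K -> measurable_fun setT N -> measurable_fun setT g ->
  (forall x, 0 <= K x) -> (forall x, 0 <= N x) -> (forall x, 0 <= g x) ->
  (forall C, measurable C ->
    P (E `&` h @^-1` C) = \int[Q]_(x in H @^-1` C) K (H x)) ->
  (forall C, measurable C -> P (h @^-1` C) = \int[Q]_(x in H @^-1` C) N (H x)) ->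
  {ae Q, forall x, 0 < N (H x) < +oo -> g (H x) * N (H x) = K (H x)} ->
  forall C, measurable C ->
    P (E `&` h @^-1` C) = \int[P]_(w in h @^-1` C) g (h w).
Proof.
move=> mh mH mE mK mN mg K0 N0 g0 PK PN gNK C mC.
have mKH : measurable_fun setT (K \o H) by exact: measurableT_comp.
have mNH : measurable_fun setT (N \o H) by exact: measurableT_comp.
have mgH : measurable_fun setT (g \o H) by exact: measurableT_comp.
have mHC D : measurable D -> measurable (H @^-1` D).
  by move=> mD; have := mH measurableT D mD; rewrite setTI.
have mhC D : measurable D -> measurable (h @^-1` D).
  by move=> mD; have := mh measurableT D mD; rewrite setTI.
have NH0 x : 0 <= (N \o H) x by exact: N0.
have m1C : measurable_fun setT (fun y : S => (\1_C y : R)%:E * g y).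
  by apply: emeasurable_funM => //; exact: emeasurable_indic.
have -> : \int[P]_(w in h @^-1` C) g (h w) =
    \int[Q]_(x in H @^-1` C) (g (H x) * N (H x)).
  rewrite (integral_indicM P) (integral_indicM Q).
  transitivity (\int[pushforward P h]_y ((\1_C y)%:E * g y)).
    by rewrite (ge0_integral_pushforward mh)// => y _; rewrite mule_ge0.
  transitivity (\int[weighted_law Q mH mNH NH0]_y ((\1_C y)%:E * g y)).
    by apply: eq_measure_integral => A mA _; exact: PN.
  rewrite integral_weighted_law//; last by move=> y; rewrite mule_ge0.
  by apply: eq_integral => x _; rewrite muleA.
rewrite PK//; apply: ge0_ae_eq_integral => //.
- exact: mHC.
- exact: measurable_funS mKH.
- by apply: (@measurable_funS _ _ _ _ setT) => //; exact: emeasurable_funM.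
- by move=> x _; rewrite mule_ge0.
have Nfin : {ae Q, forall x, N (H x) \is a fin_num}.
  have : Q.-integrable setT (N \o H).
    apply/integrableP; split=> //.
    under eq_integral do rewrite gee0_abs//.
    have := PN _ measurableT; rewrite !preimage_setT probability_setT => <-.
    exact: ltry.
  by move/(integrable_ae measurableT); apply: filterS => x; exact.
pose Z := [set y | N y = 0].
have mZ : measurable Z.
  by have := mN measurableT _ (emeasurable_set1 0); rewrite setTI.
have KZ : {ae Q, forall x, (H @^-1` Z) x -> K (H x) = 0}.
  have KHZ : \int[Q]_(x in H @^-1` Z) `|(K \o H) x| = 0.
    under eq_integral do rewrite gee0_abs ?K0//.
    rewrite -PK//; apply/eqP; rewrite eq_le measure_ge0 andbT.
    apply: (@le_trans _ _ (P (h @^-1` Z))).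
      apply: le_measure => //; rewrite inE; last exact: mhC.
      by apply: measurableI => //; exact: mhC.
    by rewrite PN// integral0_eq.
  have mKZ : measurable_fun (H @^-1` Z) (K \o H) by exact: measurable_funS mKH.
  by move/(ae_eq_integral_abs Q (mHC _ mZ) mKZ): KHZ.
near=> x => _.
have [NZ|NZ] := eqVneq (N (H x)) 0.
  rewrite NZ mule0; suff : (H @^-1` Z) x -> K (H x) = 0 by exact.
  by near: x.
rewrite (_ : g _ * _ = K (H x))//.
have : 0 < N (H x) < +oo.
  have : N (H x) \is a fin_num by near: x.
  by rewrite ge0_fin_numE// lt0e NZ N0 => ->.
by near: x.
Unshelve. all: by end_near. Qed.

End bayes.

(** * Laws of the increments of a Lévy process *)

Section levy_kernels.
Context (R : realType) (T : R) (f : R -> R -> \bar R).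
Context d' (Om' : measurableType d') (P' : probability Om' R)
  (X : R -> {RV P' >-> R}).
Hypothesis fX : levy_densities T f X.

Definition levy_law (t : R) : probability R R := distribution P' (X t).

Lemma levy_law_density t : (0 < t <= T)%R -> has_density (levy_law t) (f t).
Proof.
move=> tT; split; first exact: (density_measurable fX).
  by move=> x; exact: (density_ge0 fX).
by move=> B mB; rewrite -(density_law fX).
Qed.

Lemma chapman_kolmogorov a b c : (0 < a)%R -> (0 < b)%R -> (a + b <= T)%R ->
  \int[levy_law b]_y f a (c - y)%R = f (a + b)%R c.
Proof.
move=> a0 b0 abT.
have aT : (0 < a <= T)%R by rewrite a0 (le_trans _ abT)// lerDl ltW.
have bT : (0 < b <= T)%R by rewrite b0 (le_trans _ abT)// lerDr ltW.
have mfa : measurable_fun setT (fun y : R => f a (c - y)%R).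
  have mc : measurable_fun setT (fun y : R => c - y)%R.
    by apply: measurable_funB => //; exact: measurable_cst.
  exact: (measurableT_comp (density_measurable fX aT) mc).
rewrite (@density_convolution _ _ _ _ _ _ _ fX b)//; last by rewrite ltrDr.
rewrite addrK.
have := integral_density_shift 0 (levy_law_density bT) mfa
  (fun y => density_ge0 fX (c - y)%R aT).
under eq_integral do rewrite subr0.
by move=> ->; apply: eq_integral => y _; rewrite add0r.
Qed.

Lemma sum_tuple_cons n (a : R) (v : n.-tuple R) :
  sum_tuple [tuple of a :: v] = (a + sum_tuple v)%R.
Proof.
rewrite /sum_tuple big_ord_recl; congr (_ + _)%R.
by apply: eq_bigr => i _; rewrite tnthS.
Qed.

Lemma measurable_sum_tuple n : measurable_fun setT (@sum_tuple R n).
Proof. by apply: measurable_sum => i; exact: measurable_tnth. Qed.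

(** Removing the increments one at a time, by [chapman_kolmogorov]. *)
Lemma chapman_kolmogorov_tprod n a (b : nat -> R) c : (0 < a)%R ->
  (forall i, (i < n)%N -> (0 < b i)%R) -> (a + \sum_(i < n) b i <= T)%R ->
  \int[tprod n (fun i => levy_law (b i))]_v f a (c - sum_tuple v)%R =
  f (a + \sum_(i < n) b i)%R c.
Proof.
elim: n b c => [|n IH] b c a0 b0 abT.
  have aT : (0 < a <= T)%R by rewrite a0; move: abT; rewrite big_ord0 addr0.
  rewrite integral_tprod0; last first.
    have mc : measurable_fun setT (fun v : 0.-tuple R => c - sum_tuple v)%R.
      by apply: measurable_funB; [exact: measurable_cst|exact: measurable_sum_tuple].
    exact: (measurableT_comp (density_measurable fX aT) mc).
  by rewrite big_ord0 addr0 /sum_tuple big_ord0 subr0.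
have S0 : (0 <= \sum_(i < n) b i.+1)%R.
  by apply: sumr_ge0 => i _; apply/ltW/b0; rewrite ltnS.
have Sb : (\sum_(i < n.+1) b i = b 0%N + \sum_(i < n) b i.+1)%R.
  by rewrite big_ord_recl.
rewrite Sb; rewrite Sb in abT.
have b00 := b0 0%N isT.
have aST : (a + \sum_(i < n) b i.+1 <= T)%R.
  by rewrite (le_trans _ abT)// lerD2l lerDr ltW.
have aT : (0 < a <= T)%R by rewrite a0 (le_trans _ aST)// lerDl.
rewrite integral_tprodS; first last.
- by move=> v; exact: (density_ge0 fX).
- have mc : measurable_fun setT (fun v : n.+1.-tuple R => c - sum_tuple v)%R.
    by apply: measurable_funB; [exact: measurable_cst|exact: measurable_sum_tuple].
  exact: (measurableT_comp (density_measurable fX aT) mc).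
rewrite [in RHS](addrC (b 0%N)) addrA.
rewrite -chapman_kolmogorov//; first last.
- by rewrite -addrA (addrC _ (b 0%N)).
- by rewrite ltr_wpDr.
apply: eq_integral => x _.
rewrite -(IH (fun i => b i.+1))//; last by move=> i ni; exact: b0.
by apply: eq_integral => v _; rewrite sum_tuple_cons opprD addrA.
Qed.

End levy_kernels.

(** * Finite-dimensional laws of the bridge *)

Section bridge.
Context (R : realType) (T : R) (f : R -> R -> \bar R).
Context d' (Om' : measurableType d') (P' : probability Om' R)
  (X : R -> {RV P' >-> R}).
Hypothesis fX : levy_densities T f X.
Local Notation mu := (levy_law X).

Lemma bridge_ratio_ge0 (r x z : R) : (0 < r < T)%R -> 0 <= f r x / f T z.
Proof.
move=> /andP[r0 rT]; rewrite mule_ge0//.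
  by apply: (density_ge0 fX); rewrite r0 ltW.
by rewrite inve_ge0 (density_ge0 fX)// (lt_trans r0)/=.
Qed.

Lemma measurable_bridge_ratio (r : R) : (0 < r < T)%R ->
  measurable_fun setT (fun p : R * R => f r p.1 / f T p.2).
Proof.
move=> /andP[r0 rT].
have T0 : (0 < T <= T)%R by rewrite (lt_trans r0)/=.
apply: emeasurable_funM.
  apply: (measurableT_comp (density_measurable fX _)) => //.
  by rewrite r0 ltW.
apply: measurable_inve; last by move=> p; exact: (density_ge0 fX).
exact: (measurableT_comp (density_measurable fX T0)).
Qed.

Definition time_incr (g : nat -> R) (i : nat) := (g i.+1 - g i)%R.

(** The grid is [0 = g 0 < g 1 < ... < g k.+1 < g k.+2 = T]; it has at least one
point inside [(0, T)], as a bridge is described by its values at such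
points. *)
Section grid.
Variables (k : nat) (g : nat -> R).
Hypotheses (g0 : g 0%N = 0%R) (gT : g k.+2 = T)
  (gS : forall i, (i < k.+2)%N -> (g i < g i.+1)%R).

Lemma grid_le i j : (i <= j)%N -> (j <= k.+2)%N -> (g i <= g j)%R.
Proof.
elim: j => [|j IH]; first by rewrite leqn0 => /eqP ->.
rewrite leq_eqVlt => /predU1P[-> //|ij jk].
by rewrite (le_trans (IH ij (ltnW jk)))// ltW// gS.
Qed.

Definition grid_tuple : k.+1.-tuple R := [tuple g i.+1 | i < k.+1].

Lemma nth_grid i : (i < k.+2)%N -> nth 0%R (0%R :: grid_tuple) i = g i.
Proof.
case: i => [|i] ik; first by rewrite g0.
have ik' : (i < k.+1)%N by [].
have := tnth_mktuple (fun i : 'I_k.+1 => g i.+1) (Ordinal ik').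
by rewrite (tnth_nth 0%R).
Qed.

Lemma last_grid : last 0%R grid_tuple = g k.+1.
Proof. by rewrite (last_nth 0%R) size_tuple nth_grid. Qed.

Lemma path_grid : path <%R 0%R (rcons grid_tuple T).
Proof.
apply/(pathP 0%R) => i; rewrite size_rcons size_tuple ltnS => ik.
have sz : size (0%R :: grid_tuple) = k.+2.
  by rewrite -[LHS]/(size grid_tuple).+1 size_tuple.
rewrite -rcons_cons nth_rcons sz ltnS ik nth_grid//.
rewrite nth_rcons size_tuple; case: ltnP => ik'.
  by rewrite -[nth _ _ _]/(nth 0%R (0%R :: grid_tuple) i.+1) nth_grid// gS.
have -> : i = k.+1 by apply/eqP; rewrite eqn_leq ik ik'.
by rewrite eqxx -gT gS.
Qed.

Lemma grid_incr_in i : (i < k.+1)%N -> (0 < time_incr g i <= T)%R.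
Proof.
move=> ik; have ik' : (i < k.+2)%N by exact: ltnW.
rewrite /time_incr subr_gt0 gS//= lerBlDr -gT.
rewrite (le_trans (grid_le ik' (leqnn _)))// lerDl -g0.
by apply: grid_le => //; exact: ltnW.
Qed.

Lemma grid_rest_in : (0 < T - g k.+1 < T)%R.
Proof.
by rewrite subr_gt0 -{1}gT gS//= ltrBlDr ltrDl -g0 (lt_le_trans (gS _))// grid_le.
Qed.

(** The conditional distribution function of the bridge is an expectation over
independent increments of the Lévy process, with the weight that conditions on
the terminal value. *)
Lemma bridge_cdfE (x : k.+1.-tuple R) z :
  bridge_cdf T f grid_tuple x z =
  \int[tprod k.+1 (fun i => mu (time_incr g i))]_v
    ((\1_(orthant x) (walk 0 v))%:E *
     (f (T - g k.+1)%R (z - sum_tuple v)%R / f T z)).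
Proof.
pose psi (y : k.+1.-tuple R) := (\1_(orthant x) y)%:E *
  (f (T - g k.+1)%R (z - last 0 y)%R / f T z).
have lastwE (v : k.+1.-tuple R) : last 0%R (walk 0 v) = sum_tuple v.
  rewrite (last_nth 0%R) size_tuple/= (_ : nth _ _ _ = tnth (walk 0 v) ord_max).
    by rewrite tnth_mktuple add0r psum_full.
  by rewrite (tnth_nth 0%R).
have -> : bridge_cdf T f grid_tuple x z = lebesgue_int (fun y : k.+1.-tuple R => psi y *
    \prod_(i < k.+1) (f (time_incr g i)) (tnth y i - nth 0 (0%R :: y) i)%R).
  rewrite /bridge_cdf; congr lebesgue_int; apply/funext => y.
  rewrite /psi -muleA; congr (_ * _); rewrite /bridge_density -muleA muleC.
  rewrite last_grid; congr (_ * _); apply: eq_bigr => i _; congr f.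
  by rewrite nth_grid ?tnth_mktuple//; exact: (ltnW (ltn_ord i)).
rewrite (lebesgue_int_walk (mu := fun i => mu (time_incr g i))
  (h := fun i => f (time_incr g i))).
- by apply: eq_integral => v _; rewrite /psi lastwE.
- by move=> i ik; apply: (levy_law_density fX); exact: grid_incr_in.
- apply: emeasurable_funM; first by apply: emeasurable_indic; exact: measurable_orthant.
  have ml : measurable_fun setT (fun y : k.+1.-tuple R => (z - last 0 y, z)%R).
    apply: measurable_fun_pair; last exact: measurable_cst.
    apply: measurable_funB; first exact: measurable_cst.
    under eq_fun do rewrite (last_nth 0%R) size_tuple/= -(tnth_nth 0%R _ ord_max).
    exact: measurable_tnth.
  exact: (measurableT_comp (measurable_bridge_ratio grid_rest_in) ml).
- by move=> y; rewrite mule_ge0//; apply: bridge_ratio_ge0; exact: grid_rest_in.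
Qed.

End grid.

End bridge.

Lemma measurable_mktuple d d2 (T : measurableType d) (U : measurableType d2) n
    (F : 'I_n -> T -> U) : (forall i, measurable_fun setT (F i)) ->
  measurable_fun setT (fun w => [tuple F i w | i < n]).
Proof.
move=> mF; apply/measurable_fun_tnthP => i; rewrite /comp.
by under eq_fun do rewrite tnth_mktuple; exact: mF.
Qed.

Section levy_increments.
Context (R : realType) d (Om : measurableType d) (P : probability Om R)
  (X : R -> {RV P >-> R}).
Hypothesis levyX : levy_process X.

Definition increments k (g : nat -> R) (w : Om) : k.-tuple R :=
  [tuple (X (g i.+1) w - X (g i) w)%R | i < k].

Lemma measurable_increments k g : measurable_fun setT (@increments k g).
Proof. by apply: measurable_mktuple => i; exact: measurable_funB. Qed.

(** Stationarity and independence are stated for rectangles; orthants are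
rectangles, and they determine the law. *)
Lemma increments_law k (g : nat -> R) (phi : k.-tuple R -> \bar R) :
  (0 <= g 0%N)%R -> (forall i, (i < k)%N -> (g i <= g i.+1)%R) ->
  measurable_fun setT phi -> (forall v, 0 <= phi v) ->
  \int[P]_w phi (increments k g w) =
  \int[tprod k (fun i => levy_law X (time_incr g i))]_v phi v.
Proof.
move=> g0 gS mphi phi0; have mZ := @measurable_increments k g.
transitivity (\int[pushforward P (increments k g)]_v phi v).
  by rewrite (ge0_integral_pushforward mZ).
apply: eq_measure_integral => A mA _; apply: eq_tuple_measure_orthant mA => [|x].
  by change (P setT < +oo); rewrite probability_setT; exact: ltry.
pose E (i : nat) : set R := `]-oo, (nth 0 x i)%R]%classic.
have mE i : measurable (E i) by exact: measurable_itv.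
have orthE : orthant x = [set v | forall i : 'I_k, E i (tnth v i)].
  apply/seteqP; split=> v /= H i; have := H i.
    by rewrite /E/= in_itv/= -tnth_nth.
  by rewrite /E/= in_itv/= -tnth_nth.
rewrite orthE.
transitivity (\prod_(i < k) levy_law X (time_incr g i) (E i)); last first.
  by apply/esym; exact: (@tprod_rect R k (fun i => levy_law X (time_incr g i)) E).
transitivity (P [set w | forall i, (i < k)%N -> E i (X (g i.+1) w - X (g i) w)%R]).
  congr (P _); apply/seteqP; split=> w /= H i.
    by move=> ik; have := H (Ordinal ik); rewrite tnth_mktuple.
  by rewrite tnth_mktuple; exact: H.
rewrite (levy_indep levyX)//; apply: eq_bigr => i _.
have gi0 : (0 <= g i)%R.
  have := ltn_ord i; elim: (i : nat) => [//|j IH] jk.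
  by rewrite (le_trans (IH (ltnW jk)))// gS// ltnW.
have h0 : (0 <= time_incr g i)%R by rewrite subr_ge0 gS.
have := levy_stationary levyX gi0 h0 (mE i).
by rewrite /time_incr addrC subrK.
Qed.

End levy_increments.

Lemma measurable_walk0 (R : realType) n : measurable_fun setT (walk (0 : R) (n := n)).
Proof.
apply/measurable_fun_tnthP => i; rewrite /comp.
under eq_fun do rewrite tnth_mktuple.
by apply: measurable_funD; [exact: measurable_cst|exact: measurable_psum].
Qed.

Section bridge_law.
Context (R : realType) (T : R) (f : R -> R -> \bar R) (nu : probability R R).
Context d' (Om' : measurableType d') (P' : probability Om' R)
  (X : R -> {RV P' >-> R}).
Context d (Om : measurableType d) (P : probability Om R)
  (L : R -> {RV P >-> R}).
Hypotheses (levyX : levy_process X) (fX : levy_densities T f X)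
  (lrbL : levy_random_bridge T f nu L).
Local Notation mu := (levy_law X).

Section interior.
Variables (k : nat) (g : nat -> R).
Hypotheses (g0 : g 0%N = 0%R) (gT : g k.+2 = T)
  (gS : forall i, (i < k.+2)%N -> (g i < g i.+1)%R).

Definition bridge_weight (v : k.+1.-tuple R) (z : R) : \bar R :=
  f (T - g k.+1)%R (z - sum_tuple v)%R / f T z.

Lemma bridge_weight_ge0 v z : 0 <= bridge_weight v z.
Proof. by apply: (bridge_ratio_ge0 fX); exact: (grid_rest_in g0 gT gS). Qed.

Lemma measurable_bridge_weight :
  measurable_fun setT (fun p : k.+1.-tuple R * R => bridge_weight p.1 p.2).
Proof.
have ml : measurable_fun setT (fun p : k.+1.-tuple R * R =>
    (p.2 - sum_tuple p.1, p.2)%R).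
  apply: measurable_fun_pair; last exact: measurable_snd.
  apply: measurable_funB; first exact: measurable_snd.
  exact: (measurableT_comp (@measurable_sum_tuple R k.+1) measurable_fst).
exact: (measurableT_comp (measurable_bridge_ratio fX (grid_rest_in g0 gT gS)) ml).
Qed.

(** Both sides integrate [phi] against finite measures, which agree on products
of an orthant and a Borel set by the definition of a bridge. *)
Lemma bridge_grid_law (phi : k.+1.-tuple R * R -> \bar R) :
  measurable_fun setT phi -> (forall p, 0 <= phi p) ->
  \int[P]_w phi ([tuple L (g i.+1) w | i < k.+1], L T w) =
  \int[tprod k.+1 (fun i => mu (time_incr g i))]_v \int[nu]_z
    (phi (walk 0 v, z) * bridge_weight v z).
Proof.
move=> mphi phi0.
pose Q := tprod k.+1 (fun i => mu (time_incr g i)).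
pose HL w := ([tuple L (g i.+1) w | i < k.+1], L T w).
have mHL : measurable_fun setT HL.
  by apply: measurable_fun_pair => //; exact: measurable_mktuple.
pose HX (p : k.+1.-tuple R * R) := (walk 0 p.1, p.2).
have mHX : measurable_fun setT HX.
  apply: measurable_fun_pair; last exact: measurable_snd.
  apply: (@measurableT_comp _ _ _ _ _ _ (walk 0%R (n := k.+1)) setT fst) => //.
  exact: measurable_walk0.
pose W (p : k.+1.-tuple R * R) := bridge_weight p.1 p.2.
have mW : measurable_fun setT W by exact: measurable_bridge_weight.
have W0 p : 0 <= W p by exact: bridge_weight_ge0.
have mphiHX : measurable_fun setT (fun p => phi (HX p)).
  exact: (measurableT_comp mphi mHX).
transitivity (\int[pushforward P HL]_p phi p).
  by rewrite (ge0_integral_pushforward mHL).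
transitivity (\int[weighted_law (Q \x nu) mHX mW W0]_p phi p); last first.
  rewrite integral_weighted_law// fubini_tonelli1//.
    exact: emeasurable_funM.
  by move=> p; rewrite mule_ge0.
apply: eq_measure_integral => A mA _; apply: eq_measure_orthant mA => [|x B mB].
  by change (P setT < +oo); rewrite probability_setT; exact: ltry.
have mxB : measurable (orthant x `*` B).
  by apply: measurableX => //; exact: measurable_orthant.
have [_ /(_ B mB)] := lrb_bridge lrbL x (isT : (0 < k.+1)%N) (path_grid g0 gT gS).
rewrite (_ : [set w | _] `&` _ = HL @^-1` (orthant x `*` B)); last first.
  apply/seteqP; split=> w /= [H Bw]; split=> // i; have := H i.
    by rewrite /grid_tuple !tnth_mktuple.
  by rewrite /grid_tuple !tnth_mktuple.
move=> PE; transitivity (P (HL @^-1` (orthant x `*` B))) => //; rewrite PE.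
transitivity (\int[nu]_(z in B) bridge_cdf T f (grid_tuple k g) x z).
  by apply: eq_measure_integral => C mC _; exact: (lrb_terminal lrbL mC).
transitivity (\int[Q \x nu]_(p in HX @^-1` (orthant x `*` B)) W p) => //.
rewrite (integral_indicM nu) (integral_indicM (Q \x nu)).
have mHxB : measurable (HX @^-1` (orthant x `*` B)).
  by have := mHX measurableT _ mxB; rewrite setTI.
have mI : measurable_fun setT (fun p =>
    (\1_(HX @^-1` (orthant x `*` B)) p : R)%:E * W p).
  by apply: emeasurable_funM => //; exact: emeasurable_indic.
have I0 p : 0 <= (\1_(HX @^-1` (orthant x `*` B)) p : R)%:E * W p.
  by rewrite mule_ge0.
rewrite fubini_tonelli1// [RHS](fubini_tonelli _ mI I0).
apply: eq_integral => z _; rewrite (bridge_cdfE fX g0 gT gS).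
rewrite -ge0_integralZl//; last 2 first.
- apply: emeasurable_funM.
    have mwo := @measurable_walk0 R k.+1.
    have mo : measurable (orthant x) by exact: measurable_orthant.
    exact: (measurableT_comp (emeasurable_indic (R := R) mo) mwo).
  exact: (measurableT_comp mW (pair2_measurable z)).
- by move=> v _; rewrite mule_ge0//; exact: (W0 (v, z)).
apply: eq_integral => v _; rewrite muleA; congr (_ * _).
rewrite -EFinM; congr _%:E; rewrite !indicE/= -natrM mulnb.
congr (nat_of_bool _)%:R; apply/andP/idP; rewrite !inE/=.
  by case=> Bz wx; split.
by case=> wx Bz; split.
Qed.

End interior.

End bridge_law.

(** * The bridge starts at zero *)

Section bridge_start.
Context (R : realType) (T : R) (f : R -> R -> \bar R) (nu : probability R R).
Context d' (Om' : measurableType d') (P' : probability Om' R)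
  (X : R -> {RV P' >-> R}).
Context d (Om : measurableType d) (P : probability Om R)
  (L : R -> {RV P >-> R}).
Hypotheses (levyX : levy_process X) (fX : levy_densities T f X)
  (lrbL : levy_random_bridge T f nu L).
Local Notation mu := (levy_law X).

Let T0 : (0 < T)%R := lrb_pos lrbL.

(** A bounded continuous function vanishing only at [0], so that
[L_0 = 0] almost surely as soon as [cap L_0] has expectation [0]. *)
Definition cap (x : R) : R := Num.min 1%R `|x|%R.

Lemma cap_ge0 x : (0 <= cap x)%R.
Proof. by rewrite le_min ler01 normr_ge0. Qed.

Lemma cap_le1 x : (cap x <= 1)%R.
Proof. by rewrite ge_min lexx. Qed.

Lemma cap_eq0 x : cap x = 0%R -> x = 0%R.
Proof.
rewrite /cap; case: leP => [_ /eqP|_ /eqP]; first by rewrite oner_eq0.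
by rewrite normr_eq0 => /eqP.
Qed.

Lemma cvg_cap (u : nat -> R) l : u @ \oo --> l -> cap (u n) @[n --> \oo] --> cap l.
Proof.
move=> ul; have cl : {for l, continuous cap}.
  have c1 : {for l, continuous (cst 1%R : R -> R)} by exact: cvg_cst.
  exact: (continuous_min c1 (@norm_continuous _ R l)).
exact: (continuous_cvg _ cl ul).
Qed.

Lemma measurable_cap : measurable_fun setT cap.
Proof. by apply: measurable_minr; [exact: measurable_cst|exact: normr_measurable]. Qed.

(* Any fixed time in [(0, T)] would do: it separates the times [t_ n], which
   decrease to [0], from [T]. *)
Let s := (T / 2)%R.
Let s0 : (0 < s)%R. Proof. by rewrite divr_gt0. Qed.
Let sT : (s < T)%R. Proof. by rewrite ltr_pdivrMr// ltr_pMr// ltr1n. Qed.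

Let t_ (n : nat) : R := (s * harmonic n.+1)%R.
Let t_gt0 n : (0 < t_ n)%R. Proof. by rewrite mulr_gt0// harmonic_gt0. Qed.
Let t_lt n : (t_ n < s)%R.
Proof. by rewrite /t_ gtr_pMr// invf_lt1// ltr1n. Qed.

Let cvg_t : t_ @ \oo --> (0 : R)%R.
Proof.
have h0 : (harmonic n.+1 : R) @[n --> \oo] --> (0 : R)%R.
  by have := @cvg_harmonic R; rewrite -cvg_shiftS.
by have := cvgM (cvg_cst s : s @[_ --> \oo] --> s) h0; rewrite mulr0; exact.
Qed.

Let at_start (u : R -> R) : cadlag T u -> u (t_ n) @[n --> \oo] --> u 0%R.
Proof.
move=> [uR _]; have T00 : (0 <= (0 : R) < T)%R by rewrite lexx T0.
by have /cvg_at_rightP := uR _ T00; apply; split.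
Qed.

Let g n (i : nat) : R := nth T [:: 0%R; t_ n; s] i.

Let gS n i : (i < 3)%N -> (g n i < g n i.+1)%R.
Proof. by case: i => [|[|[|]]] //= _; rewrite /g/= ?t_gt0 ?t_lt ?sT. Qed.

(* The density, with respect to the law of [X], of the law of [L] on the
   time interval [[0, s]], as a function of the value at time [s]. *)
Let H (x : R) : \bar R := \int[nu]_z (f (T - s)%R (z - x)%R / f T z).

Let rs : (0 < T - s < T)%R.
Proof. by rewrite subr_gt0 sT/= ltrBlDr ltrDl. Qed.

Let mW : measurable_fun setT (fun p : R * R => f (T - s)%R (p.2 - p.1)%R / f T p.2).
Proof.
have ml : measurable_fun setT (fun p : R * R => (p.2 - p.1, p.2)%R).
  by apply: measurable_fun_pair => //; exact: measurable_funB.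
exact: (measurableT_comp (measurable_bridge_ratio fX rs) ml).
Qed.

Let W0 (p : R * R) : 0 <= f (T - s)%R (p.2 - p.1)%R / f T p.2.
Proof. exact: (bridge_ratio_ge0 fX). Qed.

Let mH : measurable_fun setT H.
Proof. exact: (@measurable_fun_fubini_tonelli_F _ _ _ _ _ nu _ mW W0). Qed.

Let H0 x : 0 <= H x.
Proof. by apply: integral_ge0 => z _; exact: (W0 (x, z)). Qed.

Let DX (r : R) (w : Om') : R := (X r w - X 0 w)%R.
Let mDX r : measurable_fun setT (DX r).
Proof. exact: measurable_funB. Qed.

(* It is stated with increments from [X 0], so that [X 0 = 0] almost surely
   need not be invoked. *)
Let law_early n (phi : R -> R) : measurable_fun setT phi ->
  (forall x, 0 <= phi x)%R ->
  \int[P]_w (phi (L (t_ n) w))%:E =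
  \int[P']_w ((phi (DX (t_ n) w))%:E * H (DX s w)).
Proof.
move=> mphi phi0.
have gn0 : g n 0%N = 0%R by [].
have gnT : g n 3%N = T by [].
pose psi (p : 2.-tuple R * R) := (phi (tnth p.1 ord0))%:E.
have mpsi : measurable_fun setT psi.
  apply/measurable_EFinP; apply: (measurableT_comp mphi).
  exact: (measurableT_comp (measurable_tnth ord0) measurable_fst).
have psi0 p : 0 <= psi p by rewrite lee_fin.
have := bridge_grid_law fX lrbL gn0 gnT (@gS n) mpsi psi0.
under [X in X = _ -> _]eq_integral do rewrite /psi tnth_mktuple/=.
rewrite {1}/g/= => ->.
pose F (v : 2.-tuple R) := (phi (tnth v ord0))%:E * H (sum_tuple v).
have mF : measurable_fun setT F.
  apply: emeasurable_funM.
    apply/measurable_EFinP; apply: (measurableT_comp mphi).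
    exact: measurable_tnth.
  exact: (measurableT_comp mH (@measurable_sum_tuple R 2)).
have F0 v : 0 <= F v by rewrite mule_ge0// lee_fin.
transitivity (\int[tprod 2 (fun i => mu (time_incr (g n) i))]_v F v).
  apply: eq_integral => v _; rewrite /F /H -ge0_integralZl//.
  - apply: eq_integral => z _; congr (_ * _).
    by rewrite /psi/= tnth_mktuple add0r /psum (bigD1 ord0)//= big1 ?addr0// => -[[|[|]]].
  - by have := measurableT_comp mW (pair1_measurable (sum_tuple v)).
  - by move=> z _; exact: (W0 (sum_tuple v, z)).
  - by rewrite lee_fin.
transitivity (\int[P']_w F (increments X 2 (g n) w)).
  apply/esym/(increments_law levyX) => //.
  by move=> i i2; apply/ltW/gS/ltnW.
apply: eq_integral => w _; rewrite /F /increments tnth_mktuple; congr (_ * H _).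
rewrite /sum_tuple !big_ord_recl big_ord0 !tnth_mktuple /g/= addr0.
by rewrite /DX addrC addrA subrK.
Qed.

Let H_mass : \int[P']_w H (DX s w) = 1.
Proof.
have := @law_early 0%N (cst 1%R) (measurable_cst _) (fun=> ler01).
rewrite [X in X = _](_ : _ = 1); last first.
  transitivity (\int[P]_w (cst 1 w : \bar R)) => //.
  by rewrite integral_cst// mul1e; exact: probability_setT.
by move=> ->; apply: eq_integral => w _; rewrite mul1e.
Qed.

Let H_integrable : P'.-integrable setT (fun w => H (DX s w)).
Proof.
apply/integrableP; split; first exact: (measurableT_comp mH (mDX s)).
by under eq_integral do rewrite gee0_abs//; rewrite H_mass ltry.
Qed.

(* Right-continuity of [X] at [0], with the integrable density [H] of
   [L] as the dominating function. *)
Let early_cvg0 : \int[P]_w (cap (L (t_ n) w))%:E @[n --> \oo] --> 0.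
Proof.
have mh n : measurable_fun setT (fun w => (cap (DX (t_ n) w))%:E * H (DX s w)).
  apply: emeasurable_funM; last exact: (measurableT_comp mH (mDX s)).
  by apply/measurable_EFinP; exact: (measurableT_comp measurable_cap (mDX _)).
have hcvg : {ae P', forall w, setT w ->
    (cap (DX (t_ n) w))%:E * H (DX s w) @[n --> \oo] --> (cst 0 w : \bar R)}.
  have Hfin : {ae P', forall w, H (DX s w) \is a fin_num}.
    by move/(integrable_ae measurableT): H_integrable; apply: filterS => w; exact.
  have cad := levy_cadlag levyX.
  near=> w => _.
  have Hw : H (DX s w) \is a fin_num by near: w.
  rewrite /cst -(mul0e (H (DX s w))); apply: cvgeZr => //.
  apply/cvg_EFin; first by near=> n.
  have -> : (0 = cap 0)%R by rewrite /cap normr0; apply/esym/min_idPr.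
  apply: cvg_cap; rewrite /DX.
  rewrite [X in _ --> X](_ : _ = X 0 w - X 0 w)%R; last by rewrite subrr.
  apply: cvgB; last exact: cvg_cst.
  have cw : forall T0, cadlag T0 (fun t => X t w) by near: w.
  exact: (at_start (u := fun t => X t w) (cw T)).
have hdom : {ae P', forall w n, setT w ->
    `|(cap (DX (t_ n) w))%:E * H (DX s w)| <= H (DX s w)}.
  apply: aeW => w n _; rewrite gee0_abs; last by rewrite mule_ge0// lee_fin cap_ge0.
  by rewrite -[leRHS]mul1e lee_wpmul2r// lee_fin cap_le1.
have [_ _ c] :=
  dominated_convergence measurableT mh (measurable_cst _) hcvg H_integrable hdom.
rewrite (_ : (fun n => \int[P]_w _) =
    (fun n => \int[P']_w ((cap (DX (t_ n) w))%:E * H (DX s w)))).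
  by move: c; rewrite integral0.
by apply/funext => n; rewrite law_early//; [exact: measurable_cap|exact: cap_ge0].
Unshelve. all: by end_near. Qed.

(** The bridge property constrains [L] at positive times only.  Near time [0]
its law is absolutely continuous with respect to that of [X], with a
density that does not depend on the time, so [L_t] tends to [0] in probability;
it tends to [L_0] almost surely. *)
Lemma bridge_starts_at0 : {ae P, forall w, L 0%R w = 0%R}.
Proof.
have mh r : measurable_fun setT (fun w => (cap (L r w))%:E).
  by apply/measurable_EFinP; exact: measurableT_comp measurable_cap _.
have hcvg : {ae P, forall w, setT w ->
    (cap (L (t_ n) w))%:E @[n --> \oo] --> (cap (L 0%R w))%:E}.
  have cad := lrb_cadlag lrbL; near=> w => _.
  apply/cvg_EFin; first by near=> n.
  apply: cvg_cap; have cw : cadlag T (fun t => L t w) by near: w.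
  exact: (at_start (u := fun t => L t w) cw).
have i1 : P.-integrable setT (fun _ : Om => 1%E : \bar R).
  exact: finite_measure_integrable_cst.
have hdom : {ae P, forall w n, setT w -> `|(cap (L (t_ n) w))%:E| <= 1}.
  apply: aeW => w n _; rewrite gee0_abs ?lee_fin ?cap_ge0//.
  exact: cap_le1.
have [_ _ c] := dominated_convergence measurableT (fun n => mh (t_ n)) (mh 0%R) hcvg i1 hdom.
have c0 : \int[P]_w (cap (L 0%R w))%:E = 0.
  by apply: (cvg_unique _ c early_cvg0).
have : \int[P]_w `|(cap (L 0%R w))%:E| = 0.
  by under eq_integral do rewrite gee0_abs ?lee_fin ?cap_ge0//.
move/(ae_eq_integral_abs P measurableT (mh 0%R)); apply: filterS => w /(_ I) [].
exact: cap_eq0.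
Unshelve. all: by end_near. Qed.

End bridge_start.

(** * A time grid that interleaves the coordinates *)
Lemma psumS (R : realType) n (v : n.-tuple R) l :
  psum v l.+1 = (psum v l + nth 0 v l)%R.
Proof.
have [ln|nl] := ltnP l n; last first.
  by rewrite !psum_full ?(leqW nl)// nth_default ?addr0// size_tuple.
rewrite /psum (bigD1 (Ordinal ln))//= addrC (tnth_nth 0%R)/=; congr (_ + _)%R.
by apply: eq_bigl => j; rewrite -val_eqE/= ltnS [RHS]ltn_neqAle andbC.
Qed.

Section block_grid.
Context (R : realType) (n r : nat) (m : n.+1.-tuple R) (s : nat -> R).
Hypotheses (s0 : s 0%N = 0%R) (s1 : s r.+1 = 1%R)
  (sS : forall j, (j < r.+1)%N -> (s j < s j.+1)%R)
  (m_gt0 : forall i, (0 < tnth m i)%R).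

(** The times [u_i + s_j m_i] at which a Liouville process looks at its bridge,
where [l = i * r.+1 + j].  Since [s 0 = 0] and [s r.+1 = 1], the last time
of a block is the first of the next one, so [j = r.+1] needs no entry. *)
Definition block_grid (l : nat) : R :=
  (s (l %% r.+1) * nth 0 m (l %/ r.+1) + psum m (l %/ r.+1))%R.

Lemma block_gridE i j : (i < n.+1)%N -> (j <= r.+1)%N ->
  block_grid (i * r.+1 + j) = (s j * nth 0 m i + psum m i)%R.
Proof.
move=> ni; rewrite leq_eqVlt => /predU1P[->|jr].
  rewrite -mulSnr /block_grid modnMl mulnK// s0 s1 mul0r mul1r add0r psumS.
  exact: addrC.
by rewrite /block_grid modnMDl modn_small// divnMDl// divn_small// addn0.
Qed.

Lemma block_grid_end : block_grid (n.+1 * r.+1) = sum_tuple m.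
Proof. by rewrite /block_grid modnMl mulnK// s0 mul0r add0r psum_full. Qed.

Lemma block_grid0 : block_grid 0 = 0%R.
Proof. by rewrite /block_grid mod0n div0n s0 mul0r psum0 addr0. Qed.

Let nth_m i (ni : (i < n.+1)%N) : (0 < nth 0 m i)%R.
Proof. by have := m_gt0 (Ordinal ni); rewrite (tnth_nth 0%R). Qed.

Lemma block_index l : (l < n.+1 * r.+1)%N ->
  exists i j, [/\ (i < n.+1)%N, (j < r.+1)%N & l = (i * r.+1 + j)%N].
Proof.
move=> ln; exists (l %/ r.+1)%N, (l %% r.+1)%N; split.
- by rewrite ltn_divLR.
- by rewrite ltn_mod.
- exact: divn_eq.
Qed.

Lemma time_incr_block i j : (i < n.+1)%N -> (j < r.+1)%N ->
  time_incr block_grid (i * r.+1 + j) = ((s j.+1 - s j) * nth 0 m i)%R.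
Proof.
move=> ni jr; rewrite /time_incr -addnS !block_gridE//; last exact: ltnW.
by rewrite opprD addrACA subrr addr0 mulrBl.
Qed.

Lemma block_gridS l : (l < n.+1 * r.+1)%N -> (block_grid l < block_grid l.+1)%R.
Proof.
move=> /block_index[i [j [ni jr ->]]]; rewrite -subr_gt0.
by rewrite -/(time_incr _ _) time_incr_block// mulr_gt0 ?subr_gt0 ?sS ?nth_m.
Qed.

End block_grid.

Section bridge_path.
Context (R : realType) (T : R) (f : R -> R -> \bar R) (nu : probability R R).
Context d' (Om' : measurableType d') (P' : probability Om' R)
  (X : R -> {RV P' >-> R}).
Context d (Om : measurableType d) (P : probability Om R)
  (L : R -> {RV P >-> R}).
Hypotheses (levyX : levy_process X) (fX : levy_densities T f X)
  (lrbL : levy_random_bridge T f nu L).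
Local Notation mu := (levy_law X).
Variables (k : nat) (g : nat -> R).
Hypotheses (g0 : g 0%N = 0%R) (gT : g k.+2 = T)
  (gS : forall i, (i < k.+2)%N -> (g i < g i.+1)%R).

(** [bridge_grid_law] with the value at time [0] included; it is [0] almost
surely, and is the empty partial sum on the right-hand side. *)
Lemma bridge_path_law (phi : k.+2.-tuple R * R -> \bar R) :
  measurable_fun setT phi -> (forall p, 0 <= phi p) ->
  \int[P]_w phi ([tuple L (g i) w | i < k.+2], L T w) =
  \int[tprod k.+1 (fun i => mu (time_incr g i))]_v \int[nu]_z
    (phi ([tuple psum v i | i < k.+2], z) * bridge_weight T f g v z).
Proof.
move=> mphi phi0.
pose psi (p : k.+1.-tuple R * R) := phi ([tuple of (0%R : R) :: p.1], p.2).
have mc : measurable_fun setT (fun p : k.+1.-tuple R * R =>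
    ([tuple of (0%R : R) :: p.1], p.2)).
  apply: measurable_fun_pair => //.
  by apply: measurable_cons => //; exact: measurable_cst.
have mpsi : measurable_fun setT psi by exact: (measurableT_comp mphi mc).
transitivity (\int[P]_w psi ([tuple L (g i.+1) w | i < k.+1], L T w)).
  have mL t := measurable_funP (L t).
  apply: ge0_ae_eq_integral => //.
  - apply: (measurableT_comp mphi); apply: measurable_fun_pair => //.
    by apply: measurable_mktuple.
  - apply: (measurableT_comp mpsi); apply: measurable_fun_pair => //.
    by apply: measurable_mktuple.
  - by move=> w _; exact: phi0.
  have L0 := bridge_starts_at0 levyX fX lrbL.
  near=> w => _; have L0w : L 0%R w = 0%R by near: w.
  rewrite /psi; congr (phi (_, _)).
  apply: eq_from_tnth => i; rewrite tnth_mktuple.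
  case: (unliftP ord0 i) => [j ->|->]; first by rewrite tnthS tnth_mktuple.
  by rewrite g0 L0w.
rewrite (bridge_grid_law fX lrbL g0 gT gS mpsi (fun p => phi0 _)).
apply: eq_integral => v _; apply: eq_integral => z _.
rewrite /psi; congr (phi (_, _) * _).
apply: eq_from_tnth => i; rewrite tnth_mktuple.
case: (unliftP ord0 i) => [j ->|->]; first by rewrite tnthS tnth_mktuple add0r.
by rewrite psum0.
Unshelve. all: by end_near. Qed.

End bridge_path.

(** * The path of a Liouville process *)

Section block_sums.
Context (R : realType) (r : nat).

(** The sum of the first [j] increments of block [i]: the [i]-th coordinate of
the Liouville process at the [j]-th time. *)
Definition block_sum n (v : n.-tuple R) (i j : nat) : R :=
  (psum v (i * r.+1 + j) - psum v (i * r.+1))%R.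

Lemma block_sum0 n (v : n.-tuple R) i : block_sum v i 0 = 0%R.
Proof. by rewrite /block_sum addn0 subrr. Qed.

Lemma block_sumS n (v : n.-tuple R) i j :
  block_sum v i j.+1 = (block_sum v i j + nth 0%R v (i * r.+1 + j))%R.
Proof. by rewrite /block_sum addnS psumS addrAC. Qed.

Lemma psum_block n (v : n.-tuple R) i :
  psum v (i * r.+1) = (\sum_(i' < i) block_sum v i' r.+1)%R.
Proof.
elim: i => [|i IH]; first by rewrite mul0n psum0 big_ord0.
by rewrite big_ord_recr/= -IH /block_sum -mulSnr addrC subrK.
Qed.

Lemma nth_resample n q b (x : n.-tuple R) (y : q.-tuple R) l : (l < n)%N ->
  nth 0%R (resample b x y) l =
  if [pick j : 'I_q | b j == l] is Some j then tnth y j else nth 0%R x l.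
Proof.
move=> ln; rewrite -[l]/(val (Ordinal ln)) -!(tnth_nth 0%R) tnth_mktuple.
by [].
Qed.

(** Below, the increment in place [j0] is redrawn in each of the first [p]
blocks. *)
Variables (k p j0 : nat) (v : k.-tuple R) (y : p.-tuple R).
Let b i := (i * r.+1 + j0)%N.
Hypothesis j0r : (j0 < r.+1)%N.

Lemma block_sum_resample i j : (j <= j0)%N ->
  block_sum (resample b v y) i j = block_sum v i j.
Proof.
elim: j => [|j IH] jj; first by rewrite !block_sum0.
rewrite !block_sumS IH; last exact: ltnW.
congr (_ + _)%R; have [lk|kl] := ltnP (i * r.+1 + j) k; last first.
  by rewrite !nth_default// size_tuple.
rewrite nth_resample//; case: pickP => // i' /eqP /(congr1 (modn^~ r.+1)).
rewrite /b !modnMDl !modn_small//; last exact: ltn_trans jj j0r.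
by move=> jE; rewrite jE ltnn in jj.
Qed.

Lemma block_sum_resampleS (i : 'I_p) : (b i < k)%N ->
  block_sum (resample b v y) i j0.+1 = (block_sum v i j0 + tnth y i)%R.
Proof.
move=> bk; rewrite block_sumS block_sum_resample//; congr (_ + _)%R.
rewrite nth_resample//; case: pickP => [i' /eqP /(congr1 (divn^~ r.+1))|/(_ i)].
  by rewrite /b !divnMDl// !divn_small// !addn0 => /val_inj ->.
by rewrite eqxx.
Qed.

End block_sums.

(** There are [n.+1] blocks of [r.+1] increments each.  The last one, which ends
at [T], is not drawn: the terminal value [z] takes its place.  The remaining
number [n.+1 * r.+1 - 1] of increments is written [k.+1], as it is positive in
dimension at least two. *)
Section glp_path.
Context (R : realType) (n r k : nat) (m : n.+1.-tuple R) (s : nat -> R).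
Hypotheses (kE : k.+2 = (n.+1 * r.+1)%N)
  (s0 : s 0%N = 0%R) (s1 : s r.+1 = 1%R)
  (sS : forall j, (j < r.+1)%N -> (s j < s j.+1)%R)
  (m_gt0 : forall i, (0 < tnth m i)%R).
Context (f : R -> R -> \bar R) (nu : probability R R).
Context d' (Om' : measurableType d') (P' : probability Om' R)
  (X : R -> {RV P' >-> R}).
Context d2 (Om2 : measurableType d2) (P2 : probability Om2 R)
  (L : R -> {RV P2 >-> R}).
Context d (Om : measurableType d) (P : probability Om R)
  (xi : R -> {RV P >-> n.+1.-tuple R}).
Local Notation T := (sum_tuple m).
Hypotheses (levyX : levy_process X) (fX : levy_densities T f X)
  (lrbL : levy_random_bridge T f nu L)
  (xiL : eq_in_law 1 P (fun t => xi t : Om -> n.+1.-tuple R)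
     P2 (split_process m (fun t => L t : Om2 -> R))).
Local Notation mu := (levy_law X).
Local Notation g := (block_grid r m s).
Local Notation state := (n.+1.-tuple R).

Let g0 : g 0%N = 0%R. Proof. exact: block_grid0. Qed.
Let gT : g k.+2 = T. Proof. by rewrite kE block_grid_end. Qed.
Let gS i : (i < k.+2)%N -> (g i < g i.+1)%R.
Proof. by rewrite kE; exact: block_gridS. Qed.

Lemma knE : k.+1 = (n * r.+1 + r)%N.
Proof. by move: kE; rewrite mulSnr addnS => -[]. Qed.

Lemma time_mono i j : (i <= j)%N -> (j <= r.+1)%N -> (s i <= s j)%R.
Proof.
elim: j => [|j IH]; first by rewrite leqn0 => /eqP ->.
rewrite leq_eqVlt => /predU1P[-> //|ij jk].
by rewrite (le_trans (IH ij (ltnW jk)))// ltW// sS.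
Qed.

Lemma time_in01 j : (j <= r.+1)%N -> (0 <= s j <= 1)%R.
Proof. by move=> jr; rewrite -s0 -s1 !time_mono. Qed.

Local Notation incr_law := (tprod k.+1 (fun i => mu (time_incr g i))).

(** The value of the bridge at the [l]-th time of the grid. *)
Definition level (v : k.+1.-tuple R) (z : R) (l : nat) : R :=
  if (l < k.+2)%N then psum v l else z.

Definition path_state (v : k.+1.-tuple R) (z : R) (j : nat) : state :=
  [tuple (level v z (i * r.+1 + j) - level v z (i * r.+1))%R | i < n.+1].

Lemma measurable_path_states q : measurable_fun setT
  (fun p : k.+1.-tuple R * R => [tuple path_state p.1 p.2 j | j < q]).
Proof.
apply: measurable_mktuple => j; apply: measurable_mktuple => i.
have ml l : measurable_fun setT (fun p : k.+1.-tuple R * R => level p.1 p.2 l).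
  rewrite /level; case: (l < k.+2)%N; last exact: measurable_snd.
  exact: (measurableT_comp (@measurable_psum R k.+1 l) measurable_fst).
exact: (measurable_funB (ml _) (ml _)).
Qed.

Lemma glp_path_law (phi : r.+2.-tuple state -> \bar R) :
  measurable_fun setT phi -> (forall p, 0 <= phi p) ->
  \int[P]_w phi [tuple xi (s j) w | j < r.+2] =
  \int[incr_law]_v \int[nu]_z
    (phi [tuple path_state v z j | j < r.+2] * bridge_weight T f g v z).
Proof.
move=> mphi phi0.
pose h w : r.+2.-tuple state := [tuple xi (s j) w | j < r.+2].
have mh : measurable_fun setT h by exact: measurable_mktuple.
pose h2 w : r.+2.-tuple state :=
  [tuple split_process m (fun t => L t : Om2 -> R) (s j) w | j < r.+2].
have mh2 : measurable_fun setT h2.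
  apply: measurable_mktuple => j; apply: measurable_mktuple => i.
  exact: measurable_funB.
transitivity (\int[P2]_w phi (h2 w)).
  transitivity (\int[pushforward P h]_y phi y).
    by rewrite (ge0_integral_pushforward mh).
  transitivity (\int[pushforward P2 h2]_y phi y); last first.
    by rewrite (ge0_integral_pushforward mh2).
  apply: eq_measure_integral => A mA _.
  have tin (j : 'I_r.+2) : (0 <= tnth [tuple s j | j < r.+2] j <= 1)%R.
    by rewrite tnth_mktuple; apply: time_in01; rewrite -ltnS.
  have /= := @xiL r.+2 [tuple s j | j < r.+2] A tin mA.
  rewrite (_ : [set w | _] = h @^-1` A); last first.
    apply/seteqP; split=> w /=; congr (A _); apply: eq_from_tnth => j.
      by rewrite !tnth_mktuple.
    by rewrite !tnth_mktuple.
  rewrite (_ : [set w | A [tuple split_process _ _ _ _ | _ < _]] = h2 @^-1` A) //.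
  apply/seteqP; split=> w /=; congr (A _); apply: eq_from_tnth => j.
    by rewrite !tnth_mktuple.
  by rewrite !tnth_mktuple.
pose lev (p : k.+2.-tuple R * R) l := if (l < k.+2)%N then nth 0%R p.1 l else p.2.
pose st (p : k.+2.-tuple R * R) : r.+2.-tuple state :=
  [tuple [tuple (lev p (i * r.+1 + j)%N - lev p (i * r.+1)%N)%R | i < n.+1]
     | j < r.+2].
have mst : measurable_fun setT st.
  apply: measurable_mktuple => j; apply: measurable_mktuple => i.
  have ml l : measurable_fun setT (fun p : k.+2.-tuple R * R => lev p l).
    rewrite /lev; case: ltnP => lk; last exact: measurable_snd.
    rewrite (_ : (fun p => _) = (fun p => tnth p.1 (Ordinal lk))).
      exact: (measurableT_comp (measurable_tnth (Ordinal lk)) measurable_fst).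
    by apply/funext => p; rewrite (tnth_nth 0%R).
  exact: (measurable_funB (ml _) (ml _)).
have mphist : measurable_fun setT (fun p => phi (st p)).
  exact: (measurableT_comp mphi mst).
have levE w l : (l <= k.+2)%N ->
    lev ([tuple L (g i) w | i < k.+2], L T w) l = L (g l) w.
  rewrite leq_eqVlt => /predU1P[->|lk]; rewrite /lev ?ltnn ?gT// lk.
  by rewrite -[l]/(val (Ordinal lk)) -tnth_nth tnth_mktuple.
transitivity (\int[P2]_w phi (st ([tuple L (g i) w | i < k.+2], L T w))).
  apply: eq_integral => w _; congr phi; apply: eq_from_tnth => j.
  rewrite !tnth_mktuple; apply: eq_from_tnth => i; rewrite !tnth_mktuple.
  have jr : (j <= r.+1)%N by rewrite -ltnS.
  have ik1 : (i * r.+1 + j <= k.+2)%N.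
    by rewrite kE mulSnr leq_add// leq_mul2r/= -ltnS ltn_ord.
  have ik0 : (i * r.+1 <= k.+2)%N by rewrite (leq_trans _ ik1)// leq_addr.
  have gi : g (i * r.+1)%N = psum m i.
    by rewrite -[(i * r.+1)%N]addn0 block_gridE// s0 mul0r add0r.
  by rewrite !levE// gi block_gridE// (tnth_nth 0%R).
rewrite (bridge_path_law levyX fX lrbL g0 gT gS mphist (fun p => phi0 _)).
apply: eq_integral => v _; apply: eq_integral => z _.
congr (phi _ * _); apply: eq_from_tnth => j; rewrite !tnth_mktuple.
apply: eq_from_tnth => i; rewrite !tnth_mktuple /lev /level/=.
have H l : (l < k.+2)%N -> nth 0%R [tuple psum v i0 | i0 < k.+2] l = psum v l.
  by move=> lk; rewrite -[l]/(val (Ordinal lk)) -tnth_nth tnth_mktuple.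
by congr (_ - _)%R; case: ltnP => // lk; exact: H.
Qed.

End glp_path.

(** * Past and terminal state *)
Lemma lift_max_widen n (j : 'I_n) : lift ord_max j = widen_ord (leqnSn n) j.
Proof. by apply: val_inj; rewrite /= /bump leqNgt ltn_ord. Qed.

Lemma eq_tprod (R : realType) n (mu nu : nat -> probability R R) :
  (forall i, (i < n)%N -> mu i = nu i) -> tprod n mu = tprod n nu.
Proof.
elim: n mu nu => // n IH mu nu munu.
pose F (a : probability R R) (b : probability (n.-tuple R) R) :
    probability (n.+1.-tuple R) R := distribution (a \x b) (@tcons R n).
have tprodS (p : nat -> probability R R) :
  tprod n.+1 p = F (p 0%N) (tprod n (fun i => p i.+1)) by [].
by rewrite !tprodS munu// (IH _ (fun i => nu i.+1))// => i ni; exact: munu.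
Qed.

(** The coordinates of a terminal state sum to [L_T], so the last one is
determined by [z = L_T] and the other ones. *)
Definition terminal_state (R : realType) n (zeta : n.-tuple R) (z : R) :
    n.+1.-tuple R :=
  [tuple of rcons zeta (z - sum_tuple zeta)%R].

Lemma terminal_state_front (R : realType) n (zeta : n.-tuple R) z (i : 'I_n) :
  tnth (terminal_state zeta z) (widen_ord (leqnSn n) i) = tnth zeta i.
Proof. by rewrite !(tnth_nth 0%R)/= nth_rcons size_tuple ltn_ord. Qed.

Lemma terminal_state_last (R : realType) n (zeta : n.-tuple R) z :
  tnth (terminal_state zeta z) ord_max = (z - sum_tuple zeta)%R.
Proof. by rewrite (tnth_nth 0%R)/= nth_rcons size_tuple ltnn eqxx. Qed.

Lemma measurable_terminal_state (R : realType) n : measurable_fun setT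
  (fun p : n.-tuple R * R => terminal_state p.1 p.2).
Proof.
apply/measurable_fun_tnthP => i; rewrite /comp.
have [[j ->]|->] : (exists j, i = widen_ord (leqnSn n) j) \/ i = ord_max.
- case: (unliftP ord_max i) => [j ->|->]; [left; exists j|by right].
  exact: lift_max_widen.
- under eq_fun do rewrite terminal_state_front.
  exact: (measurableT_comp (measurable_tnth j) measurable_fst).
- under eq_fun do rewrite terminal_state_last.
  apply: measurable_funB; first exact: measurable_snd.
  exact: (measurableT_comp (@measurable_sum_tuple R n) measurable_fst).
Qed.

Lemma sum_tuple_front (R : realType) n (x : n.+1.-tuple R) :
  sum_tuple x = (sum_tuple (front_tuple x) + tnth x ord_max)%R.
Proof.
rewrite /sum_tuple big_ord_recr/=; congr (_ + _)%R.
by apply: eq_bigr => i _; rewrite tnth_mktuple.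
Qed.

Lemma sum_tuple_tadd (R : realType) n (x y : n.-tuple R) :
  sum_tuple (tadd x y) = (sum_tuple x + sum_tuple y)%R.
Proof.
by rewrite /sum_tuple -big_split/=; apply: eq_bigr => i _; rewrite tnth_mktuple.
Qed.

Lemma strict_time_eq0 (R : realType) (s : nat -> R) r : s 0%N = 0%R ->
  (forall j, (j < r)%N -> (s j < s j.+1)%R) -> s r = 0%R -> r = 0%N.
Proof.
move=> s0 sS sr0; case: r sS sr0 => // r sS sr0.
have : (s 0%N < s r.+1)%R.
  elim: r sS {sr0} => [|r IH] sS; first exact: sS.
  rewrite (lt_trans (IH _))// => [j jr|]; first by apply: sS; exact: ltnW.
  exact: sS.
by rewrite s0 sr0 ltxx.
Qed.

(** The past as a function of the increments; [b.+1] is the size of a block. *)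
Definition history (R : realType) n b k q (v : k.-tuple R) : q.-tuple (n.+1.-tuple R) :=
  [tuple [tuple block_sum b v i j | i < n.+1] | j < q].

Lemma measurable_history (R : realType) n b k q :
  measurable_fun setT (@history R n b k q).
Proof.
apply: measurable_mktuple => j; apply: measurable_mktuple => i.
exact: (measurable_funB (@measurable_psum R k _) (@measurable_psum R k _)).
Qed.

Lemma history0_sum (R : realType) n b k r (v : k.-tuple R) : r = 0%N ->
  sum_tuple (tnth (@history R n b k r.+1 v) ord_max) = 0%R.
Proof.
by move=> ->; rewrite /sum_tuple big1// => i _; rewrite !tnth_mktuple block_sum0.
Qed.

Section glp_laws.
Context (R : realType) (n r k : nat) (m : n.+1.-tuple R) (s : nat -> R).
Hypotheses (kE : k.+2 = (n.+1 * r.+1)%N)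
  (s0 : s 0%N = 0%R) (s1 : s r.+1 = 1%R)
  (sS : forall j, (j < r.+1)%N -> (s j < s j.+1)%R)
  (m_gt0 : forall i, (0 < tnth m i)%R).
Context (f : R -> R -> \bar R) (nu : probability R R).
Context d' (Om' : measurableType d') (P' : probability Om' R)
  (X : R -> {RV P' >-> R}).
Context d2 (Om2 : measurableType d2) (P2 : probability Om2 R)
  (L : R -> {RV P2 >-> R}).
Context d (Om : measurableType d) (P : probability Om R)
  (xi : R -> {RV P >-> n.+1.-tuple R}).
Local Notation T := (sum_tuple m).
Hypotheses (levyX : levy_process X) (fX : levy_densities T f X)
  (lrbL : levy_random_bridge T f nu L)
  (xiL : eq_in_law 1 P (fun t => xi t : Om -> n.+1.-tuple R)
     P2 (split_process m (fun t => L t : Om2 -> R))).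
Local Notation mu := (levy_law X).
Local Notation g := (block_grid r m s).
Local Notation state := (n.+1.-tuple R).
Local Notation incr_law := (tprod k.+1 (fun i => mu (time_incr g i))).

Local Notation history := (@history R n r k.+1).

Let knE := knE kE.

Lemma path_stateE (v : k.+1.-tuple R) z j : (j <= r)%N ->
  path_state n r (v : k.+1.-tuple R) z j = [tuple block_sum r v i j | i < n.+1].
Proof.
move=> jr; apply: eq_from_tnth => i; rewrite !tnth_mktuple /level.
have ik : (i * r.+1 + j < k.+2)%N.
  by rewrite ltnS knE leq_add// leq_mul2r/= -ltnS ltn_ord.
by rewrite ik (leq_ltn_trans _ ik)// leq_addr.
Qed.

(** The weight of the bridge once the increments after time [t] are known in all
coordinates but the last.  It depends on the past through [x] only. *)
Definition terminal_weight (t : R) (x : state) (zeta : n.-tuple R) (z : R) : \bar R :=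
  f ((1 - t) * tnth m ord_max)%R (z - (tnth x ord_max + sum_tuple zeta))%R
  / f T z.

Lemma remaining_time :
  (T - g k.+1 = (1 - s r) * tnth m ord_max)%R.
Proof.
rewrite knE (block_gridE m s0 s1)// (tnth_nth 0%R)/=.
rewrite -(psum_full m (leqnn n.+1)) psumS mulrBl mul1r.
by rewrite [(psum m n + _)%R]addrC opprD addrACA subrr addr0.
Qed.

Lemma incr_in_range i j : (i < n.+1)%N -> (j < r.+1)%N ->
  time_incr g (i * r.+1 + j) = ((s j.+1 - s j) * nth 0 m i)%R.
Proof. by move=> ni jr; rewrite (time_incr_block m s0 s1). Qed.

Let g0 : g 0%N = 0%R. Proof. exact: block_grid0. Qed.
Let gT : g k.+2 = T. Proof. by rewrite kE block_grid_end. Qed.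
Let gS i : (i < k.+2)%N -> (g i < g i.+1)%R.
Proof. by rewrite kE; exact: block_gridS. Qed.

Lemma remaining_time_in : (0 < (1 - s r) * tnth m ord_max < T)%R.
Proof. by rewrite -remaining_time; exact: (grid_rest_in g0 gT gS). Qed.

Lemma terminal_weight_ge0 x zeta z : 0 <= terminal_weight (s r) x zeta z.
Proof. by apply: (bridge_ratio_ge0 fX); exact: remaining_time_in. Qed.

Lemma measurable_terminal_weight d3 (U : measurableType d3) (x : U -> state)
    (zeta : U -> n.-tuple R) (z : U -> R) :
  measurable_fun setT x -> measurable_fun setT zeta -> measurable_fun setT z ->
  measurable_fun setT (fun p => terminal_weight (s r) (x p) (zeta p) (z p)).
Proof.
move=> mx mzeta mz.
have ml : measurable_fun setT
    (fun p => (z p - (tnth (x p) ord_max + sum_tuple (zeta p)), z p)%R).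
  apply: measurable_fun_pair => //; apply: measurable_funB => //.
  apply: measurable_funD; first exact: (measurableT_comp (measurable_tnth ord_max) mx).
  exact: (measurableT_comp (@measurable_sum_tuple R n) mzeta).
exact: (measurableT_comp (measurable_bridge_ratio fX remaining_time_in) ml).
Qed.

(** The unnormalised law of the terminal state given that the process is in [x]
at time [t]. *)
Definition terminal_kernel (t : R) (phi : state -> \bar R) (x : state) : \bar R :=
  \int[tprod n (fun i => mu ((1 - t) * nth 0 m i)%R)]_y \int[nu]_z
    (phi (terminal_state (tadd (front_tuple x) y) z) *
     terminal_weight t x (tadd (front_tuple x) y) z).

(** The last increments of the blocks, apart from the one replaced by the
terminal value, are redrawn.  The history does not contain them, and the weight
contains them through the sum of the terminal coordinates. *)
Lemma terminal_law (phi : r.+1.-tuple state * state -> \bar R) :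
  measurable_fun setT phi -> (forall p, 0 <= phi p) ->
  \int[P]_w phi ([tuple xi (s j) w | j < r.+1], xi 1%R w) =
  \int[incr_law]_v terminal_kernel (s r) (fun z => phi (history r.+1 v, z))
    (tnth (history r.+1 v) ord_max).
Proof.
move=> mphi phi0.
pose w1 := widen_ord (leqnSn r.+1).
pose phi' (t : r.+2.-tuple state) :=
  phi ([tuple tnth t (w1 j) | j < r.+1], tnth t ord_max).
have mphi' : measurable_fun setT phi'.
  have mt : measurable_fun setT (fun t : r.+2.-tuple state =>
      ([tuple tnth t (w1 j) | j < r.+1], tnth t ord_max)).
    apply: measurable_fun_pair; last exact: measurable_tnth.
    by apply: measurable_mktuple => j; exact: measurable_tnth.
  exact: (measurableT_comp mphi mt).
transitivity (\int[P]_w phi' [tuple xi (s j) w | j < r.+2]).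
  apply: eq_integral => w _; rewrite /phi' tnth_mktuple/= s1; congr (phi (_, _)).
  by apply: eq_from_tnth => j; rewrite !tnth_mktuple.
rewrite (glp_path_law kE s0 s1 sS m_gt0 levyX fX lrbL xiL mphi' (fun p => phi0 _)).
pose G (v : k.+1.-tuple R) := \int[nu]_z (phi' [tuple path_state n r v z j | j < r.+2] *
  bridge_weight T f g v z).
have mI : measurable_fun setT (fun p : k.+1.-tuple R * R =>
    phi' [tuple path_state n r p.1 p.2 j | j < r.+2] * bridge_weight T f g p.1 p.2).
  apply: emeasurable_funM; last exact: (measurable_bridge_weight fX g0 gT gS).
  exact: (measurableT_comp mphi' (@measurable_path_states R n r k r.+2)).
have I0 (p : k.+1.-tuple R * R) : 0 <= phi' [tuple path_state n r p.1 p.2 j | j < r.+2] *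
    bridge_weight T f g p.1 p.2.
  by apply: mule_ge0; [exact: phi0|exact (bridge_weight_ge0 fX g0 gT gS _ _)].
have mG : measurable_fun setT G.
  exact: (@measurable_fun_fubini_tonelli_F _ _ _ _ _ nu _ mI I0).
have G0 v : 0 <= G v by apply: integral_ge0 => z _; exact: (I0 (v, z)).
pose b i := (i * r.+1 + r)%N.
have bk i : (i < n)%N -> (b i < k.+1)%N.
  by move=> ni; rewrite knE ltn_add2r ltn_mul2r.
have binj i j : (i < n)%N -> (j < n)%N -> b i = b j -> i = j.
  by move=> _ _ /addIn /eqP; rewrite eqn_mul2r/= => /eqP.
transitivity (\int[incr_law]_v G v) => //.
rewrite (integral_resample _ bk binj mG G0).
apply: eq_integral => v _; rewrite /terminal_kernel.
rewrite (@eq_tprod _ n _ (fun i => mu ((1 - s r) * nth 0 m i)%R)); last first.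
  by move=> i ni /=; rewrite incr_in_range ?s1// ltnW.
apply: eq_integral => y _; apply: eq_integral => z _.
set v' := resample b v y; set x := tnth (history _ v) ord_max.
set zeta := tadd (front_tuple x) y.
have psumE : psum v' (n * r.+1) = sum_tuple zeta.
  rewrite psum_block /sum_tuple; apply: eq_bigr => i _.
  rewrite tnth_mktuple /front_tuple tnth_mktuple /x tnth_mktuple tnth_mktuple/=.
  by rewrite block_sum_resampleS//; exact: bk.
have xn : tnth x ord_max = block_sum r v n r by rewrite /x !tnth_mktuple.
congr (phi (_, _) * _).
- apply: eq_from_tnth => j; have jr : (j <= r)%N by rewrite -ltnS.
  rewrite !tnth_mktuple path_stateE//.
  apply: eq_from_tnth => i; rewrite !tnth_mktuple.
  by rewrite block_sum_resample.
- rewrite tnth_mktuple; apply: eq_from_tnth => i; rewrite tnth_mktuple.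
  case: (unliftP ord_max i) => [j ->|->].
    rewrite lift_max_widen terminal_state_front /level/= -mulSnr.
    have jk : (j.+1 * r.+1 < k.+2)%N.
      by rewrite ltnS knE (leq_trans (leq_mul (ltn_ord j) (leqnn _)))// leq_addr.
    rewrite jk (leq_ltn_trans _ jk)// ?leq_mul2r ?leqnSn ?orbT//.
    rewrite mulSnr -/(block_sum r v' j r.+1) block_sum_resampleS//; last exact: bk.
    by rewrite tnth_mktuple /front_tuple tnth_mktuple /x !tnth_mktuple.
  rewrite terminal_state_last /level/= -mulSnr -kE ltnn psumE.
  by rewrite ifT// ltnS knE leq_addr.
- rewrite /bridge_weight /terminal_weight remaining_time; congr (f _ _ / _).
  congr (_ - _)%R; rewrite xn -psumE.
  rewrite -(block_sum_resample v y (leqnn r.+1) n (leqnn r)) /block_sum subrK.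
  by rewrite psum_full// -knE.
Qed.

Lemma time_r_lt1 : (s r < 1)%R.
Proof. by rewrite -s1 sS. Qed.

Lemma time_r_ge0 : (0 <= s r)%R.
Proof. by have /andP[] := time_in01 s0 s1 sS (leqnSn r). Qed.

(** At time [0], [Theta] is [1] by definition, whereas the integral is that of
[f_T (z - c) / f_T z]; they agree at [c = 0], the only possible value then. *)
Lemma integral_bridge_ratio t c : (0 <= t < 1)%R -> (t = 0%R -> c = 0%R) ->
  \int[nu]_z (f (T * (1 - t))%R (z - c)%R / f T z) = Theta f nu T t c.
Proof.
move=> t01 tc; rewrite /Theta /theta; case: eqP => // t0.
rewrite t0 subr0 mulr1 (tc t0).
transitivity (\int[nu]_z (cst 1 z : \bar R)); last first.
  by rewrite integral_cst// mul1e.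
have T0 : (0 < T <= T)%R by rewrite (lrb_pos lrbL) lexx.
apply: ge0_ae_eq_integral => //.
- apply: emeasurable_funM.
    under eq_fun do rewrite subr0; exact: (density_measurable fX T0).
  apply: measurable_inve; first exact: (density_measurable fX T0).
  by move=> z; exact: (density_ge0 fX).
- move=> z _; rewrite mule_ge0 ?inve_ge0//; exact: (density_ge0 fX).
have fpos := lrb_density_pos lrbL.
near=> z => _; rewrite subr0 /cst/=.
have : 0 < f T z < +oo by near: z.
move=> /andP[fz0 fzoo]; apply: divee; last by rewrite gt_eqF.
by rewrite ge0_fin_numE// ltW.
Unshelve. all: by end_near. Qed.

Lemma integral_ck_ratio p (b : nat -> R) a c : (0 < a)%R ->
  (forall i, (i < p)%N -> (0 < b i)%R) -> (a + \sum_(i < p) b i <= T)%R ->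
  (a < T)%R ->
  \int[tprod p (fun i => mu (b i))]_y
    \int[nu]_z (f a (z - (c + sum_tuple y))%R / f T z) =
  \int[nu]_z (f (a + \sum_(i < p) b i)%R (z - c)%R / f T z).
Proof.
move=> a0 b0 abT aT.
have a0T : (0 < a < T)%R by rewrite a0 aT.
have mI : measurable_fun setT (fun p : p.-tuple R * R =>
    f a (p.2 - (c + sum_tuple p.1))%R / f T p.2).
  have ml : measurable_fun setT (fun p : p.-tuple R * R =>
      (p.2 - (c + sum_tuple p.1), p.2)%R).
    apply: measurable_fun_pair; last exact: measurable_snd.
    apply: measurable_funB; first exact: measurable_snd.
    apply: measurable_funD; first exact: measurable_cst.
    exact: (measurableT_comp (@measurable_sum_tuple R p) measurable_fst).
  exact: (measurableT_comp (measurable_bridge_ratio fX a0T) ml).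
rewrite (fubini_tonelli _ mI (fun q => bridge_ratio_ge0 fX _ _ a0T)).
apply: eq_integral => z _.
have aTle : (0 < a <= T)%R by rewrite a0 ltW.
rewrite /= ge0_integralZr//.
- rewrite -(chapman_kolmogorov_tprod fX _ a0 b0 abT); congr (_ / _).
  by apply: eq_integral => y _; rewrite opprD addrA.
- have mc : measurable_fun setT (fun v : p.-tuple R => z - (c + sum_tuple v))%R.
    apply: measurable_funB; first exact: measurable_cst.
    apply: measurable_funD; first exact: measurable_cst.
    exact: measurable_sum_tuple.
  exact: (measurableT_comp (density_measurable fX aTle) mc).
- by move=> y _; exact: (density_ge0 fX).
- by rewrite inve_ge0 (density_ge0 fX)// (lrb_pos lrbL)/=.
Qed.

Lemma sum_front_m :
  (sum_tuple m = \sum_(i < n) nth 0 m i + tnth m ord_max)%R.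
Proof.
rewrite sum_tuple_front; congr (_ + _)%R.
by apply: eq_bigr => i _; rewrite tnth_mktuple (tnth_nth 0%R).
Qed.

Let nth_m_gt0 i : (i < n.+1)%N -> (0 < nth 0 m i)%R.
Proof. by move=> ni; have := m_gt0 (Ordinal ni); rewrite (tnth_nth 0%R). Qed.

(** The remaining increments of the coordinates last [(1 - s_r) m_i], altogether
[T (1 - s_r)]; by Chapman-Kolmogorov their densities convolve to the one
in the definition of [Theta]. *)
Lemma terminal_kernel_mass x : (s r = 0%R -> sum_tuple x = 0%R) ->
  terminal_kernel (s r) (cst 1) x = Theta f nu T (s r) (sum_tuple x).
Proof.
move=> sx; rewrite -integral_bridge_ratio//; last first.
  by rewrite time_r_ge0 time_r_lt1.
have /andP[a0 aT] := remaining_time_in.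
have sr0 : (0 < 1 - s r)%R by rewrite subr_gt0 time_r_lt1.
have aE : (T * (1 - s r) = (1 - s r) * tnth m ord_max +
    \sum_(i < n) (1 - s r) * nth 0 m i)%R.
  by rewrite sum_front_m mulrC -mulr_sumr -mulrDr (addrC (tnth m ord_max)).
pose b i := ((1 - s r) * nth 0 m i)%R.
have b0 i : (i < n)%N -> (0 < b i)%R.
  by move=> ni; rewrite mulr_gt0// nth_m_gt0// ltnW.
have abT : ((1 - s r) * tnth m ord_max + \sum_(i < n) b i <= T)%R.
  by rewrite -aE ler_piMr// ?(ltW (lrb_pos lrbL))// gerBl time_r_ge0.
rewrite aE; have <- := integral_ck_ratio (sum_tuple x) a0 b0 abT aT.
apply: eq_integral => y _; apply: eq_integral => z _.
rewrite mul1e /terminal_weight sum_tuple_tadd (sum_tuple_front x).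
congr (f _ (_ - _)%R / _).
by rewrite addrA (addrC (tnth x ord_max)).
Qed.

Lemma history_start (v : k.+1.-tuple R) : s r = 0%R ->
  sum_tuple (tnth (history r.+1 v) ord_max) = 0%R.
Proof.
move=> sr0; apply: history0_sum; apply: (strict_time_eq0 s0 _ sr0) => j jr.
by apply: sS; exact: ltnW.
Qed.

(** The marginal of [terminal_law], whose kernel integrates to [Theta]. *)
Lemma history_law (psi : r.+1.-tuple state -> \bar R) :
  measurable_fun setT psi -> (forall h, 0 <= psi h) ->
  \int[P]_w psi [tuple xi (s j) w | j < r.+1] =
  \int[incr_law]_v (psi (history r.+1 v) *
    Theta f nu T (s r) (sum_tuple (tnth (history r.+1 v) ord_max))).
Proof.
move=> mpsi psi0.
have mp : measurable_fun setT (fun p : r.+1.-tuple state * state => psi p.1).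
  exact: (measurableT_comp mpsi measurable_fst).
transitivity (\int[P]_w (fun p : r.+1.-tuple state * state => psi p.1)
    ([tuple xi (s j) w | j < r.+1], xi 1%R w)) => //.
rewrite (terminal_law mp (fun p => psi0 _)).
apply: eq_integral => v _.
rewrite -terminal_kernel_mass; last exact: history_start.
set x := tnth _ _; rewrite /terminal_kernel/=.
have mtw : measurable_fun setT (fun p : n.-tuple R * R =>
    terminal_weight (s r) x (tadd (front_tuple x) p.1) p.2).
  apply: measurable_terminal_weight; [exact: measurable_cst| |exact: measurable_snd].
  exact: (measurableT_comp (@measurable_tadd R n)
    (measurableT_comp (pair1_measurable (front_tuple x)) measurable_fst)).
have tw0 (p : n.-tuple R * R) :
  0 <= terminal_weight (s r) x (tadd (front_tuple x) p.1) p.2 by exact: terminal_weight_ge0.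
rewrite -ge0_integralZl//.
- apply: eq_integral => y _; rewrite -ge0_integralZl//.
  + by apply: eq_integral => z _; rewrite mul1e.
  + under eq_fun do rewrite mul1e.
    exact: (measurableT_comp mtw (pair1_measurable y)).
  + by move=> z _; rewrite mul1e; exact: (tw0 (y, z)).
- under eq_fun do under eq_integral do rewrite mul1e.
  exact: (@measurable_fun_fubini_tonelli_F _ _ _ _ _ nu _ mtw tw0).
- move=> y _; apply: integral_ge0 => z _; rewrite mul1e; exact: (tw0 (y, z)).
Qed.

End glp_laws.

(** * Past and intermediate state *)

Section theta_regularity.
Context (R : realType) (f : R -> R -> \bar R) (nu : probability R R) (T : R).
Context d' (Om' : measurableType d') (P' : probability Om' R)
  (X : R -> {RV P' >-> R}).
Hypotheses (fX : levy_densities T f X) (T0 : (0 < T)%R).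

Lemma theta_time_in t : (0 < t < 1)%R -> (0 < T * (1 - t) < T)%R.
Proof.
move=> /andP[t0 t1]; rewrite mulr_gt0 ?subr_gt0//=.
by rewrite gtr_pMr// gtrBl.
Qed.

Lemma theta_ge0 t B x : (0 <= t < 1)%R -> 0 <= theta f nu T t B x.
Proof.
move=> /andP[t0 t1]; rewrite /theta; case: eqP => // /eqP tn0.
apply: integral_ge0 => z _; apply: (bridge_ratio_ge0 fX).
by apply: theta_time_in; rewrite lt0r tn0 t0 t1.
Qed.

Lemma measurable_theta_translate t B d3 (U : measurableType d3) (c x : U -> R) :
  (0 < t < 1)%R -> measurable B ->
  measurable_fun setT c -> measurable_fun setT x ->
  measurable_fun setT (fun p => theta f nu T t (translate B (c p)) (x p)).
Proof.
move=> t01 mB mc mx.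
have aT := theta_time_in t01.
have tn0 : (t == 0%R) = false by apply: gt_eqF; case/andP: t01.
have -> : (fun p => theta f nu T t (translate B (c p)) (x p)) =
    (fun p => \int[nu]_z ((\1_B (z - c p)%R)%:E *
      (f (T * (1 - t))%R (z - x p)%R / f T z))).
  apply/funext => p; rewrite /theta tn0 integral_indicM.
  by apply: eq_integral => z _; rewrite !indicE.
have mzc : measurable_fun setT (fun q : U * R => q.2 - c q.1)%R.
  apply: measurable_funB => //; exact: (measurableT_comp mc measurable_fst).
have mzx : measurable_fun setT (fun q : U * R => (q.2 - x q.1, q.2)%R).
  apply: measurable_fun_pair => //; apply: measurable_funB => //.
  exact: (measurableT_comp mx measurable_fst).
have mw : measurable_fun setT (fun q : U * R =>
    (\1_B (q.2 - c q.1)%R)%:E * (f (T * (1 - t))%R (q.2 - x q.1)%R / f T q.2)).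
  apply: emeasurable_funM.
    exact: (measurableT_comp (emeasurable_indic (R := R) mB) mzc).
  exact: (measurableT_comp (measurable_bridge_ratio fX aT) mzx).
apply: (@measurable_fun_fubini_tonelli_F _ _ _ _ _ nu _ mw) => q.
by rewrite mule_ge0//; exact: (bridge_ratio_ge0 fX).
Qed.

Lemma measurable_Theta t : (0 <= t < 1)%R ->
  measurable_fun setT (Theta f nu T t).
Proof.
move=> /andP[t0 t1]; have [->|tn0] := eqVneq t 0%R.
  by rewrite /Theta /theta eqxx; exact: measurable_cst.
have t01 : (0 < t < 1)%R by rewrite lt0r tn0 t0 t1.
have := measurable_theta_translate t01 measurableT (@measurable_cst _ _ R R setT 0%R)
  (@measurable_id _ R setT).
by rewrite /Theta /translate.
Qed.

End theta_regularity.

Section glp_transition.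
Context (R : realType) (n r k : nat) (m : n.+1.-tuple R) (s : nat -> R).
Hypotheses (kE : k.+2 = (n.+1 * r.+2)%N)
  (s0 : s 0%N = 0%R) (s1 : s r.+2 = 1%R)
  (sS : forall j, (j < r.+2)%N -> (s j < s j.+1)%R)
  (m_gt0 : forall i, (0 < tnth m i)%R).
Context (f : R -> R -> \bar R) (nu : probability R R).
Context d' (Om' : measurableType d') (P' : probability Om' R)
  (X : R -> {RV P' >-> R}).
Context d2 (Om2 : measurableType d2) (P2 : probability Om2 R)
  (L : R -> {RV P2 >-> R}).
Context d (Om : measurableType d) (P : probability Om R)
  (xi : R -> {RV P >-> n.+1.-tuple R}).
Local Notation T := (sum_tuple m).
Hypotheses (levyX : levy_process X) (fX : levy_densities T f X)
  (lrbL : levy_random_bridge T f nu L)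
  (xiL : eq_in_law 1 P (fun t => xi t : Om -> n.+1.-tuple R)
     P2 (split_process m (fun t => L t : Om2 -> R))).
Local Notation mu := (levy_law X).
Local Notation g := (block_grid r.+1 m s).
Local Notation state := (n.+1.-tuple R).
Local Notation incr_law := (tprod k.+1 (fun i => mu (time_incr g i))).
Local Notation history := (@history R n r.+1 k.+1).
Local Notation t := (s r.+1).

(** The unnormalised law of the state at time [b] given that the process is in
[x] at time [a]. *)
Definition transition_kernel (a b : R) (phi : state -> \bar R) (x : state) :
    \bar R :=
  \int[tprod n.+1 (fun i => mu ((b - a) * nth 0 m i)%R)]_y
    (phi (tadd x y) * Theta f nu T b (sum_tuple (tadd x y))).

Let T0 : (0 < T)%R := lrb_pos lrbL.

Let t01 : (0 < t < 1)%R.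
Proof.
rewrite (time_r_lt1 s1 sS) andbT -s0.
by rewrite (le_lt_trans (time_mono sS (leq0n r) (ltnW (leqnSn r.+1))))// sS.
Qed.

Let t01' : (0 <= t < 1)%R.
Proof. by have /andP[t0 ->] := t01; rewrite ltW. Qed.

(** [history_law] describes the past up to [t = s r.+1]; here the increments from
[s r] to [t] are redrawn in all coordinates, and they reach the weight
only through the new state. *)
Lemma transition_law (phi : r.+1.-tuple state * state -> \bar R) :
  measurable_fun setT phi -> (forall p, 0 <= phi p) ->
  \int[P]_w phi ([tuple xi (s j) w | j < r.+1], xi (s r.+1) w) =
  \int[incr_law]_v transition_kernel (s r) t (fun z => phi (history r.+1 v, z))
    (tnth (history r.+1 v) ord_max).
Proof.
move=> mphi phi0.
pose w1 := widen_ord (leqnSn r.+1).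
pose psi (h : r.+2.-tuple state) :=
  phi ([tuple tnth h (w1 j) | j < r.+1], tnth h ord_max).
have mpsi : measurable_fun setT psi.
  have mt : measurable_fun setT (fun h : r.+2.-tuple state =>
      ([tuple tnth h (w1 j) | j < r.+1], tnth h ord_max)).
    apply: measurable_fun_pair; last exact: measurable_tnth.
    by apply: measurable_mktuple => j; exact: measurable_tnth.
  exact: (measurableT_comp mphi mt).
transitivity (\int[P]_w psi [tuple xi (s j) w | j < r.+2]).
  apply: eq_integral => w _; rewrite /psi tnth_mktuple; congr (phi (_, _)).
  by apply: eq_from_tnth => j; rewrite !tnth_mktuple.
rewrite (history_law kE s0 s1 sS m_gt0 levyX fX lrbL xiL mpsi (fun h => phi0 _)).
pose G (v : k.+1.-tuple R) := psi (history r.+2 v) *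
  Theta f nu T t (sum_tuple (tnth (history r.+2 v) ord_max)).
have mhist q : measurable_fun setT (history q) by exact: measurable_history.
have mG : measurable_fun setT G.
  apply: emeasurable_funM; first exact: (measurableT_comp mpsi (mhist _)).
  apply: (measurableT_comp (measurable_Theta nu fX T0 t01')).
  apply: (measurableT_comp (@measurable_sum_tuple R n.+1)).
  exact: (measurableT_comp (measurable_tnth ord_max) (mhist _)).
have G0 v : 0 <= G v.
  by apply: mule_ge0; [exact: phi0|exact: (theta_ge0 nu fX T0)].
pose b i := (i * r.+2 + r)%N.
have kn : k.+1 = (n * r.+2 + r.+1)%N by exact: knE kE.
have bk i : (i < n.+1)%N -> (b i < k.+1)%N.
  by move=> ni; rewrite kn /b -addSn addSnnS leq_add// leq_mul2r/= -ltnS.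
have binj i j : (i < n.+1)%N -> (j < n.+1)%N -> b i = b j -> i = j.
  by move=> _ _ /addIn /eqP; rewrite eqn_mul2r/= => /eqP.
transitivity (\int[incr_law]_v G v) => //.
rewrite (integral_resample _ bk binj mG G0).
apply: eq_integral => v _; rewrite /transition_kernel.
rewrite (@eq_tprod _ n.+1 _ (fun i => mu ((s r.+1 - s r) * nth 0 m i)%R)); last first.
  by move=> i ni /=; rewrite (time_incr_block m s0 s1).
apply: eq_integral => y _.
set v' := resample b v y; set x := tnth (history _ v) ord_max.
have lastE : tnth (history r.+2 v') ord_max = tadd x y.
  apply: eq_from_tnth => i; rewrite !tnth_mktuple/=.
  by rewrite (block_sum_resampleS v y (leqnSn r.+1) (bk i (ltn_ord i))) /x !tnth_mktuple.
rewrite /G /psi lastE; congr (phi (_, _) * _).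
apply: eq_from_tnth => j; have jr : (j <= r)%N by rewrite -ltnS.
rewrite !tnth_mktuple; apply: eq_from_tnth => i; rewrite !tnth_mktuple.
by rewrite (block_sum_resample v y (leqnSn r.+1) i jr).
Qed.

Lemma transition_kernel_mass x : (s r = 0%R -> sum_tuple x = 0%R) ->
  transition_kernel (s r) t (cst 1) x = Theta f nu T (s r) (sum_tuple x).
Proof.
move=> sx.
have sr01 : (0 <= s r < 1)%R.
  have /andP[-> _] := time_in01 s0 s1 sS (ltnW (leqnSn r.+1)).
  by have /andP[_] := t01; apply: lt_trans; apply: sS.
rewrite -(integral_bridge_ratio fX lrbL)//.
pose b i := ((s r.+1 - s r) * nth 0 m i)%R.
have b0 i : (i < n.+1)%N -> (0 < b i)%R.
  move=> ni; rewrite mulr_gt0 ?subr_gt0 ?sS//.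
  by have := m_gt0 (Ordinal ni); rewrite (tnth_nth 0%R).
have aE : (T * (1 - s r) = T * (1 - t) + \sum_(i < n.+1) b i)%R.
  rewrite /b -mulr_sumr (_ : \sum_(i < n.+1) _ = T)%R; last first.
    by apply: eq_bigr => i _; rewrite (tnth_nth 0%R).
  by rewrite (mulrC _ T) -mulrDr addrA subrK.
have /andP[a0 aT] := theta_time_in T0 t01.
have abT : (T * (1 - t) + \sum_(i < n.+1) b i <= T)%R.
  by rewrite -aE ler_piMr// ?(ltW T0)// gerBl; case/andP: sr01.
rewrite aE; have <- := integral_ck_ratio fX lrbL (sum_tuple x) a0 b0 abT aT.
apply: eq_integral => y _; rewrite mul1e sum_tuple_tadd.
rewrite -(integral_bridge_ratio fX lrbL)// => t0.
by move: t01; rewrite t0 ltxx.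
Qed.

End glp_transition.

(** * The natural filtration *)

Section history_pi_system.
Context (R : realType) d d' (Om : measurableType d) (S : measurableType d')
  (P : probability Om R) (X : R -> {RV P >-> S}) (s : R).
Hypothesis s0 : (0 <= s)%R.

Let cylinder N (a : nat -> R) (B : nat -> set S) : set Om :=
  [set w | forall i, (i < N)%N -> B i (X (a i) w)].

(* Cylinders over arbitrary finite families of times: unlike those over
   increasing grids, they are visibly stable under intersection. *)
Let G : set (set Om) := [set D | exists N a B,
  (forall i, (i < N)%N -> (0 <= a i <= s)%R /\ measurable (B i)) /\
  D = cylinder N a B].

Let measurable_bounded_bigcap d1 (T : measurableType d1) N (F : nat -> set T) :
  (forall i, (i < N)%N -> measurable (F i)) ->
  measurable [set w | forall i, (i < N)%N -> F i w].
Proof.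
move=> mF; rewrite (_ : [set w | _] = \bigcap_(i in `I_N) F i).
  by apply: fin_bigcap_measurable => //; exact: finite_II.
by apply/seteqP; split=> w /= H i; exact: H.
Qed.

Let measurable_preimage t (B : set S) : measurable B -> measurable (X t @^-1` B).
Proof.
have mX : measurable_fun setT (X t) by exact: measurable_funP.
by move=> mB; have := mX measurableT B mB; rewrite setTI.
Qed.

Let Gm : G `<=` measurable.
Proof.
move=> _ [N [a [B [aB ->]]]]; apply: measurable_bounded_bigcap => i iN.
by apply: measurable_preimage; case: (aB i iN).
Qed.

Let GI : setI_closed G.
Proof.
move=> _ _ [N [a [B [aB ->]]]] [N' [a' [B' [aB' ->]]]].
exists (N + N')%N, (fun i => if (i < N)%N then a i else a' (i - N)%N),
  (fun i => if (i < N)%N then B i else B' (i - N)%N); split.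
  move=> i iNN; case: ltnP => [|Ni]; first exact: aB.
  by apply: aB'; rewrite ltn_subLR.
apply/seteqP; split=> w /=.
  move=> [H H'] i iNN; case: ltnP => [|Ni]; first exact: H.
  by apply: H'; rewrite ltn_subLR.
move=> H; split=> i iN.
  by have := H i; rewrite iN (leq_trans iN (leq_addr _ _)); exact.
have := H (N + i)%N; rewrite ltn_add2l iN => /(_ isT).
by rewrite ltnNge leq_addr/= addKn.
Qed.

Let GT : G setT.
Proof.
exists 0%N, (fun=> 0%R), (fun=> setT); split=> //.
by apply/seteqP; split.
Qed.

(** Sorting the times, with [0] and [s] added, gives a strictly increasing grid
from [0] to [s] on which the laws of the process are known. *)
Lemma time_grid (N : nat) (a : nat -> R) :
  (forall i, (i < N)%N -> (0 <= a i <= s)%R) ->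
  exists (r : nat) (sigma : nat -> R) (idx : nat -> nat),
    [/\ sigma 0%N = 0%R, sigma r = s,
        forall j, (j < r)%N -> (sigma j < sigma j.+1)%R &
        forall i, (i < N)%N -> (idx i <= r)%N /\ a i = sigma (idx i)].
Proof.
move=> a0s; pose l := sort <=%R (undup (0%R :: s :: mkseq a N)).
have meml x : (x \in l) = (x \in 0%R :: s :: mkseq a N) by rewrite mem_sort mem_undup.
have lt_l : sorted <%R l by rewrite sort_lt_sorted undup_uniq.
have l_gt0 : (0 < size l)%N.
  rewrite lt0n size_eq0; apply/eqP => l0; have := meml 0%R.
  by rewrite l0 in_nil inE eqxx.
have in0s x : x \in l -> (0 <= x <= s)%R.
  rewrite meml !inE => /or3P[/eqP ->|/eqP ->|/mapP[i]]; rewrite ?lexx ?s0//.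
  by rewrite mem_iota/= => iN ->; exact: a0s.
have sz j : (j <= (size l).-1)%N = (j < size l)%N by rewrite -[in RHS](prednK l_gt0).
have idx_le x : x \in l -> (index x l <= (size l).-1)%N.
  by move=> xl; rewrite sz index_mem.
have le_nth i j : (i <= j)%N -> (j < size l)%N -> (nth 0%R l i <= nth 0%R l j)%R.
  move=> ij jl; rewrite (lt_sorted_leq_nth 0%R lt_l)// inE//.
  exact: leq_ltn_trans ij jl.
have l0 : 0%R \in l by rewrite meml inE eqxx.
have ls : s \in l by rewrite meml !inE eqxx orbT.
exists (size l).-1, (nth 0%R l), (fun i => index (a i) l); split.
- apply/eqP; rewrite eq_le; apply/andP; split.
    rewrite -[leRHS](nth_index 0%R l0); apply: le_nth => //.
    by rewrite index_mem.
  by have /in0s/andP[] : nth 0%R l 0%N \in l by exact: mem_nth.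
- have lt_last : ((size l).-1 < size l)%N by rewrite prednK.
  apply/eqP; rewrite eq_le; apply/andP; split.
    by have /in0s/andP[] : nth 0%R l (size l).-1 \in l by exact: mem_nth.
  by rewrite -[leLHS](nth_index 0%R ls); apply: le_nth => //; exact: idx_le.
- move=> j jl; rewrite (lt_sorted_ltn_nth 0%R lt_l)// inE.
    by rewrite -sz ltnW.
  by rewrite -sz.
- move=> i iN; have ail : a i \in l.
    by rewrite meml !inE map_f ?orbT// mem_iota.
  by split; [exact: idx_le|rewrite nth_index].
Qed.

(** As functions of [C] both sides are finite measures, so they agree on the
generated sigma-algebra once they agree on the pi-system of cylinders. *)
Lemma eq_on_natural_filtration (E : set Om) (g : S -> \bar R) :
  measurable E -> measurable_fun setT g -> (forall x, 0 <= g x) ->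
  (forall (r : nat) (sigma : nat -> R), sigma 0%N = 0%R -> sigma r = s ->
     (forall j, (j < r)%N -> (sigma j < sigma j.+1)%R) ->
     forall C : set (r.+1.-tuple S), measurable C ->
     let h w := [tuple X (sigma j) w | j < r.+1] in
     P (E `&` h @^-1` C) = \int[P]_(w in h @^-1` C) g (X s w)) ->
  forall C, natural_filtration X s C ->
    P (E `&` C) = \int[P]_(w in C) g (X s w).
Proof.
move=> mE mg g0 gE C FC.
have mid : measurable_fun setT (@id Om) by [].
have mgX : measurable_fun setT (fun w => g (X s w)).
  exact: (measurableT_comp mg (measurable_funP (X s))).
have gX0 w : 0 <= g (X s w) by [].
suff : mrestr P mE C = weighted_law P mid mgX gX0 C by rewrite /mrestr setIC.
apply: (@g_sigma_algebra_measure_unique _ _ _ G Gm (fun=> setT)) => //.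
- by rewrite bigcup_const.
- move=> _ [N [a [B [aB ->]]]].
  have [r [sigma [idx [sig0 sigr sigS idxE]]]] :=
    time_grid (fun i iN => (aB i iN).1).
  pose C' : set (r.+1.-tuple S) :=
    [set h | forall i, (i < N)%N -> B i (tnth h (inord (idx i)))].
  have mC' : measurable C'.
    apply: (@measurable_bounded_bigcap _ _ N
      (fun i => (fun h => tnth h (inord (idx i))) @^-1` B i)) => i iN.
    have mt : measurable_fun setT (fun h : r.+1.-tuple S => tnth h (inord (idx i))).
      exact: measurable_tnth.
    have [_ mB] := aB i iN.
    by have := mt measurableT (B i) mB; rewrite setTI.
  have cylE : cylinder N a B = (fun w => [tuple X (sigma j) w | j < r.+1]) @^-1` C'.
    apply/seteqP; split=> w /= H i iN; have [ir aE] := idxE i iN; have := H i iN.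
      by rewrite tnth_mktuple inordK// -aE.
    by rewrite tnth_mktuple inordK// -aE.
  have := gE r sigma sig0 sigr sigS C' mC'.
  by rewrite /mrestr setIC cylE.
- move=> _; change (P (setT `&` E) < +oo).
  by rewrite setTI (le_lt_trans (probability_le1 P mE))// ltry.
- apply: smallest_sub FC; first exact: smallest_sigma_algebra.
  move=> A [u /= us [B mB <-]]; apply: sub_sigma_algebra.
  exists 1%N, (fun=> u), (fun=> B); split=> //; rewrite setTI.
  by apply/seteqP; split=> w /= H; [move=> []|exact: (H 0%N)].
Qed.

End history_pi_system.

(** * Conditional probabilities given the past *)
Lemma probability_indicM (R : realType) d d1 d2 (Om : measurableType d)
    (U : measurableType d1) (V : measurableType d2) (P : probability Om R)
    (h : Om -> U) (Z : Om -> V) (C : set U) (A : set V) :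
  measurable_fun setT h -> measurable_fun setT Z ->
  measurable C -> measurable A ->
  P (Z @^-1` A `&` h @^-1` C) = \int[P]_w ((\1_C (h w))%:E * (\1_A (Z w))%:E).
Proof.
move=> mh mZ mC mA.
have mhC : measurable (h @^-1` C) by have := mh measurableT C mC; rewrite setTI.
have mZA : measurable (Z @^-1` A) by have := mZ measurableT A mA; rewrite setTI.
transitivity (\int[P]_w (\1_(Z @^-1` A `&` h @^-1` C) w)%:E).
  by rewrite integral_indic ?setIT//; exact: measurableI.
apply: eq_integral => w _; rewrite -EFinM !indicE in_setI -natrM mulnb andbC.
by [].
Qed.

Section posterior_on_filtration.
Context (R : realType) (n : nat) d (Om : measurableType d) (P : probability Om R)
  (xi : R -> {RV P >-> n.+1.-tuple R}) (s t : R).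
Local Notation state := (n.+1.-tuple R).

(** [K] and [N] are evaluated at the present state while the past is observed on
an arbitrary grid up to time [s]: if the same [K] and [N] serve all grids, then
their quotient is the conditional probability given the whole past. *)
Lemma posterior_on_filtration (A : set state) (K N g : state -> \bar R) :
  (0 <= s)%R -> measurable A ->
  measurable_fun setT K -> measurable_fun setT N -> measurable_fun setT g ->
  (forall x, 0 <= K x) -> (forall x, 0 <= N x) -> (forall x, 0 <= g x) ->
  (forall x, 0 < N x < +oo -> g x * N x = K x) ->
  (forall r (sigma : nat -> R), sigma 0%N = 0%R -> sigma r = s ->
     (forall j, (j < r)%N -> (sigma j < sigma j.+1)%R) ->
     exists k (Q : probability (k.-tuple R) R) (H : k.-tuple R -> r.+1.-tuple state),
     let h w := [tuple xi (sigma j) w | j < r.+1] in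
     [/\ measurable_fun setT H,
       forall C, measurable C -> P (xi t @^-1` A `&` h @^-1` C) =
         \int[Q]_(v in H @^-1` C) K (tnth (H v) ord_max) &
       forall C, measurable C -> P (h @^-1` C) =
         \int[Q]_(v in H @^-1` C) N (tnth (H v) ord_max)]) ->
  forall C, natural_filtration xi s C ->
    P (xi t @^-1` A `&` C) = \int[P]_(w in C) g (xi s w).
Proof.
move=> s_ge0 mA mK mN mg K0 N0 g0 gNK law.
have mxi u : measurable_fun setT (xi u) by exact: measurable_funP.
apply: eq_on_natural_filtration => //.
  by have := mxi t measurableT A mA; rewrite setTI.
move=> r sigma sig0 sigr sigS C mC h.
have [k [Q [H [mH PK PN]]]] := law r sigma sig0 sigr sigS.
have mh : measurable_fun setT h by exact: measurable_mktuple.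
have mlast : measurable_fun setT (fun y : r.+1.-tuple state => tnth y ord_max).
  exact: measurable_tnth.
have hs w : tnth (h w) ord_max = xi s w by rewrite tnth_mktuple/= sigr.
rewrite (@posterior_of_ratio _ _ _ _ _ _ _ P Q h H _
  (fun y => K (tnth y ord_max)) (fun y => N (tnth y ord_max))
  (fun y => g (tnth y ord_max)))//.
- by apply: eq_integral => w _; rewrite hs.
- by have := mxi t measurableT A mA; rewrite setTI.
- exact: (measurableT_comp mK mlast).
- exact: (measurableT_comp mN mlast).
- exact: (measurableT_comp mg mlast).
- by apply: aeW => v; exact: gNK.
Qed.

End posterior_on_filtration.

Section glp_posteriors.
Context (R : realType) (n : nat) (m : n.+1.-tuple R).
Hypotheses (n_gt0 : (0 < n)%N) (m_gt0 : forall i, (0 < tnth m i)%R).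
Context (f : R -> R -> \bar R) (nu : probability R R).
Context d' (Om' : measurableType d') (P' : probability Om' R)
  (X : R -> {RV P' >-> R}).
Context d2 (Om2 : measurableType d2) (P2 : probability Om2 R)
  (L : R -> {RV P2 >-> R}).
Context d (Om : measurableType d) (P : probability Om R)
  (xi : R -> {RV P >-> n.+1.-tuple R}).
Local Notation T := (sum_tuple m).
Hypotheses (levyX : levy_process X) (fX : levy_densities T f X)
  (lrbL : levy_random_bridge T f nu L)
  (xiL : eq_in_law 1 P (fun t => xi t : Om -> n.+1.-tuple R)
     P2 (split_process m (fun t => L t : Om2 -> R))).
Local Notation mu := (levy_law X).
Local Notation state := (n.+1.-tuple R).

Let T0 : (0 < T)%R := lrb_pos lrbL.

Let measurable_Theta_sum s : (0 <= s < 1)%R ->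
  measurable_fun setT (fun x : state => Theta f nu T s (sum_tuple x)).
Proof.
move=> s01; have mT := measurable_Theta nu fX T0 s01.
exact: (measurableT_comp mT (@measurable_sum_tuple R n.+1)).
Qed.

(* This is where the dimension is at least two: the last coordinate then
   does not use up the whole bridge. *)
Let last_m_lt : (tnth m ord_max < T)%R.
Proof.
rewrite sum_front_m ltrDr; case: n m n_gt0 m_gt0 => // p m' _ m'0.
rewrite big_ord_recl ltr_wpDr//.
  apply: sumr_ge0 => i _; have ip : (lift ord0 i < p.+2)%N.
    exact: (ltnW (ltn_ord (lift ord0 i))).
  by have := m'0 (Ordinal ip); rewrite (tnth_nth 0%R) => /ltW.
by have := m'0 ord0; rewrite (tnth_nth 0%R).
Qed.

Lemma terminal_time_in s : (0 <= s < 1)%R ->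
  (0 < (1 - s) * tnth m ord_max < T)%R.
Proof.
move=> /andP[s0 s1]; rewrite mulr_gt0 ?subr_gt0//=.
by rewrite (le_lt_trans _ last_m_lt)// ler_piMl ?(ltW (m_gt0 _))// gerBl.
Qed.

Let measurable_terminal_integrand s (phi : state -> \bar R) :
  (0 <= s < 1)%R -> measurable_fun setT phi ->
  measurable_fun setT (fun p : (state * n.-tuple R) * R =>
    phi (terminal_state (tadd (front_tuple p.1.1) p.1.2) p.2) *
    terminal_weight m f s p.1.1 (tadd (front_tuple p.1.1) p.1.2) p.2).
Proof.
move=> s01 mphi.
have mfront : measurable_fun setT (@front_tuple R n).
  by apply: measurable_mktuple => i; exact: measurable_tnth.
have mx : measurable_fun setT (fun p : (state * n.-tuple R) * R => p.1.1).
  exact: (measurableT_comp measurable_fst measurable_fst).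
have mz : measurable_fun setT (fun p : (state * n.-tuple R) * R =>
    tadd (front_tuple p.1.1) p.1.2).
  have mp : measurable_fun setT (fun p : (state * n.-tuple R) * R =>
      (front_tuple p.1.1, p.1.2)).
    apply: measurable_fun_pair; first exact: (measurableT_comp mfront mx).
    exact: (measurableT_comp measurable_snd measurable_fst).
  exact: (measurableT_comp (@measurable_tadd R n) mp).
apply: emeasurable_funM.
  apply: (measurableT_comp mphi).
  have mp := measurable_fun_pair mz (@measurable_snd _ _ (state * n.-tuple R)%type R).
  exact: (measurableT_comp (@measurable_terminal_state R n) mp).
have ml : measurable_fun setT (fun p : (state * n.-tuple R) * R =>
    (p.2 - (tnth p.1.1 ord_max + sum_tuple (tadd (front_tuple p.1.1) p.1.2)), p.2)%R).
  apply: measurable_fun_pair; last exact: measurable_snd.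
  apply: measurable_funB; first exact: measurable_snd.
  apply: measurable_funD; first exact: (measurableT_comp (measurable_tnth ord_max) mx).
  exact: (measurableT_comp (@measurable_sum_tuple R n) mz).
exact: (measurableT_comp (measurable_bridge_ratio fX (terminal_time_in s01)) ml).
Qed.

Let terminal_integrand_ge0 s (phi : state -> \bar R) x zeta z :
  (0 <= s < 1)%R -> (forall y, 0 <= phi y) ->
  0 <= phi (terminal_state zeta z) * terminal_weight m f s x zeta z.
Proof.
move=> s01 phi0; rewrite mule_ge0//; apply: (bridge_ratio_ge0 fX).
exact: terminal_time_in.
Qed.

Lemma terminal_kernel_indicM s (U : Type) (C : set U) (c : U)
    (phi : state -> \bar R) x :
  terminal_kernel m f nu X s (fun z => (\1_C c)%:E * phi z) x =
  (\1_C c)%:E * terminal_kernel m f nu X s phi x.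
Proof.
rewrite indicE; case: (c \in C) => /=.
  by under eq_fun do rewrite mul1e; rewrite mul1e.
rewrite mul0e; apply: integral0_eq => y _; apply: integral0_eq => z _.
by rewrite !mul0e.
Qed.

Lemma transition_kernel_indicM a b (U : Type) (C : set U) (c : U)
    (phi : state -> \bar R) x :
  transition_kernel m f nu X a b (fun z => (\1_C c)%:E * phi z) x =
  (\1_C c)%:E * transition_kernel m f nu X a b phi x.
Proof.
rewrite indicE; case: (c \in C) => /=.
  by under eq_fun do rewrite mul1e; rewrite mul1e.
by rewrite mul0e; apply: integral0_eq => y _; rewrite !mul0e.
Qed.

Lemma measurable_terminal_kernel s (phi : state -> \bar R) :
  (0 <= s < 1)%R -> measurable_fun setT phi -> (forall y, 0 <= phi y) ->
  measurable_fun setT (terminal_kernel m f nu X s phi).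
Proof.
move=> s01 mphi phi0.
have mI := measurable_terminal_integrand s01 mphi.
have mJ := @measurable_fun_fubini_tonelli_F _ _ _ _ _ nu _ mI
  (fun p => terminal_integrand_ge0 _ _ _ s01 phi0).
apply: (@measurable_fun_fubini_tonelli_F _ _ _ _ _ (tprod n _) _ mJ) => p.
by apply: integral_ge0 => z _; exact: terminal_integrand_ge0.
Qed.

Lemma terminal_kernel_ge0 s (phi : state -> \bar R) x :
  (0 <= s < 1)%R -> (forall y, 0 <= phi y) ->
  0 <= terminal_kernel m f nu X s phi x.
Proof.
move=> s01 phi0; apply: integral_ge0 => y _; apply: integral_ge0 => z _.
exact: terminal_integrand_ge0.
Qed.

Let measurable_transition_integrand b (phi : state -> \bar R) :
  (0 <= b < 1)%R -> measurable_fun setT phi ->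
  measurable_fun setT (fun p : state * state =>
    phi (tadd p.1 p.2) * Theta f nu T b (sum_tuple (tadd p.1 p.2))).
Proof.
move=> b01 mphi; have mt := @measurable_tadd R n.+1.
apply: emeasurable_funM; first exact: (measurableT_comp mphi mt).
exact: (measurableT_comp (measurable_Theta_sum b01) mt).
Qed.

Lemma measurable_transition_kernel a b (phi : state -> \bar R) :
  (0 <= b < 1)%R -> measurable_fun setT phi -> (forall y, 0 <= phi y) ->
  measurable_fun setT (transition_kernel m f nu X a b phi).
Proof.
move=> b01 mphi phi0.
apply: (@measurable_fun_fubini_tonelli_F _ _ _ _ _ (tprod n.+1 _) _
  (measurable_transition_integrand b01 mphi)) => p.
by rewrite mule_ge0//; exact: (theta_ge0 nu fX T0).
Qed.

Lemma transition_kernel_ge0 a b (phi : state -> \bar R) x :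
  (0 <= b < 1)%R -> (forall y, 0 <= phi y) ->
  0 <= transition_kernel m f nu X a b phi x.
Proof.
move=> b01 phi0; apply: integral_ge0 => y _.
by rewrite mule_ge0//; exact: (theta_ge0 nu fX T0).
Qed.

Let kernel_size r : exists k, k.+2 = (n.+1 * r.+1)%N.
Proof.
have : (1 < n.+1 * r.+1)%N.
  by rewrite (leq_trans (_ : 1 < n.+1)%N)// leq_pmulr.
by case: (_ * _)%N => [|[|k]] // _; exists k.
Qed.

(** Each grid up to [s] is prolonged by the time [1], and [terminal_law] and
[history_law] supply the densities for Bayes' rule. *)
Lemma terminal_posterior s (A : set state) (g : state -> \bar R) :
  (0 <= s < 1)%R -> measurable A ->
  measurable_fun setT g -> (forall x, 0 <= g x) ->
  (forall x, 0 < Theta f nu T s (sum_tuple x) < +oo ->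
     g x * Theta f nu T s (sum_tuple x) =
     terminal_kernel m f nu X s (fun y => (\1_A y)%:E) x) ->
  forall C, natural_filtration xi s C ->
    P (xi 1%R @^-1` A `&` C) = \int[P]_(w in C) g (xi s w).
Proof.
move=> s01 mA mg g0 gNK; have /andP[s_ge0 s_lt1] := s01.
have m1A : measurable_fun setT (fun y => (\1_A y : R)%:E).
  exact: emeasurable_indic.
apply: (posterior_on_filtration s_ge0 mA _ _ mg _ _ g0 gNK).
- exact: measurable_terminal_kernel.
- exact: measurable_Theta_sum.
- by move=> x; exact: terminal_kernel_ge0.
- by move=> x; exact: (theta_ge0 nu fX T0).
move=> r sigma sig0 sigr sigS.
have [k kE] := kernel_size r.
pose S j := if (j <= r)%N then sigma j else 1%R.
have S0 : S 0%N = 0%R by [].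
have S1 : S r.+1 = 1%R by rewrite /S ltnn.
have Sr : S r = s by rewrite /S leqnn.
have SS j : (j < r.+1)%N -> (S j < S j.+1)%R.
  rewrite ltnS leq_eqVlt => /predU1P[->|jr]; first by rewrite S1 Sr.
  by rewrite /S ltnW// jr sigS.
have hE w : [tuple xi (S j) w | j < r.+1] = [tuple xi (sigma j) w | j < r.+1].
  by apply: eq_from_tnth => j; rewrite !tnth_mktuple /S -ltnS ltn_ord.
exists k.+1, (tprod k.+1 (fun i => mu (time_incr (block_grid r m S) i))),
  (@history R n r k.+1 r.+1); move=> h; split; first exact: measurable_history.
- move=> C mC.
  pose phi (p : r.+1.-tuple state * state) := (\1_C p.1 : R)%:E * (\1_A p.2 : R)%:E.
  have mphi : measurable_fun setT phi.
    apply: emeasurable_funM; last exact: (measurableT_comp m1A measurable_snd).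
    exact: (measurableT_comp (emeasurable_indic (R := R) mC) measurable_fst).
  have phi0 p : 0 <= phi p by rewrite mule_ge0.
  have mh : measurable_fun setT h by exact: measurable_mktuple.
  have mxi1 : measurable_fun setT (xi 1%R) by exact: measurable_funP.
  rewrite (probability_indicM P mh mxi1 mC mA).
  transitivity (\int[P]_w phi ([tuple xi (S j) w | j < r.+1], xi 1%R w)).
    by apply: eq_integral => w _; rewrite hE.
  rewrite (terminal_law kE S0 S1 SS m_gt0 levyX fX lrbL xiL mphi phi0) Sr.
  rewrite [RHS]integral_indicM; apply: eq_integral => v _.
  exact: terminal_kernel_indicM.
- move=> C mC.
  have mpsi : measurable_fun setT (fun y : r.+1.-tuple state => (\1_C y : R)%:E).
    exact: emeasurable_indic.
  have mh : measurable_fun setT h by exact: measurable_mktuple.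
  have mhC : measurable (h @^-1` C) by have := mh measurableT C mC; rewrite setTI.
  transitivity (\int[P]_w (\1_C [tuple xi (S j) w | j < r.+1])%:E).
    transitivity (\int[P]_w (\1_(h @^-1` C) w)%:E).
      by rewrite integral_indic ?setIT.
    by apply: eq_integral => w _; rewrite hE.
  rewrite (history_law kE S0 S1 SS m_gt0 levyX fX lrbL xiL mpsi (indic_ge0 _ C)).
  by rewrite Sr [RHS]integral_indicM.
Qed.

(** As for [terminal_posterior], with a grid prolonged by the times [t] and
[1]. *)
Lemma transition_posterior s t (A : set state) (g : state -> \bar R) :
  (0 <= s)%R -> (s < t)%R -> (t < 1)%R -> measurable A ->
  measurable_fun setT g -> (forall x, 0 <= g x) ->
  (forall x, 0 < Theta f nu T s (sum_tuple x) < +oo ->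
     g x * Theta f nu T s (sum_tuple x) =
     transition_kernel m f nu X s t (fun y => (\1_A y)%:E) x) ->
  forall C, natural_filtration xi s C ->
    P (xi t @^-1` A `&` C) = \int[P]_(w in C) g (xi s w).
Proof.
move=> s_ge0 st t1 mA mg g0 gNK.
have s01 : (0 <= s < 1)%R by rewrite s_ge0 (lt_trans st).
have t01 : (0 <= t < 1)%R by rewrite t1 (le_trans s_ge0)// ltW.
have m1 D : measurable D -> measurable_fun setT (fun y : state => (\1_D y : R)%:E).
  exact: emeasurable_indic.
apply: (posterior_on_filtration s_ge0 mA _ _ mg _ _ g0 gNK).
- by apply: measurable_transition_kernel => //; exact: m1.
- exact: measurable_Theta_sum.
- by move=> x; exact: transition_kernel_ge0.
- by move=> x; exact: (theta_ge0 nu fX T0).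
move=> r sigma sig0 sigr sigS.
have [k kE] := kernel_size r.+1.
pose S j := if (j <= r)%N then sigma j else if j == r.+1 then t else 1%R.
have S0 : S 0%N = 0%R by [].
have S1 : S r.+2 = 1%R by rewrite /S ltnNge leqnSn/= eqn_leq ltnn.
have St : S r.+1 = t by rewrite /S ltnn eqxx.
have Sr : S r = s by rewrite /S leqnn.
have SS j : (j < r.+2)%N -> (S j < S j.+1)%R.
  rewrite ltnS leq_eqVlt => /predU1P[->|]; first by rewrite S1 St.
  rewrite ltnS leq_eqVlt => /predU1P[->|jr]; first by rewrite St Sr.
  by rewrite /S ltnW// jr sigS.
have hE w : [tuple xi (S j) w | j < r.+1] = [tuple xi (sigma j) w | j < r.+1].
  by apply: eq_from_tnth => j; rewrite !tnth_mktuple /S -ltnS ltn_ord.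
pose Q := tprod k.+1 (fun i => mu (time_incr (block_grid r.+1 m S) i)).
exists k.+1, Q, (@history R n r.+1 k.+1 r.+1).
move=> h; have mh : measurable_fun setT h by exact: measurable_mktuple.
have law C D : measurable C -> measurable D -> P (xi t @^-1` D `&` h @^-1` C) =
    \int[Q]_(v in @history R n r.+1 k.+1 r.+1 @^-1` C)
      transition_kernel m f nu X s t (fun y => (\1_D y)%:E)
        (tnth (history n r.+1 r.+1 v) ord_max).
  move=> mC mD.
  pose phi (p : r.+1.-tuple state * state) := (\1_C p.1 : R)%:E * (\1_D p.2 : R)%:E.
  have mphi : measurable_fun setT phi.
    apply: emeasurable_funM; last exact: (measurableT_comp (m1 _ mD) measurable_snd).
    exact: (measurableT_comp (emeasurable_indic (R := R) mC) measurable_fst).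
  have phi0 p : 0 <= phi p by rewrite mule_ge0.
  have mxit : measurable_fun setT (xi t) by exact: measurable_funP.
  rewrite (probability_indicM P mh mxit mC mD).
  transitivity (\int[P]_w phi ([tuple xi (S j) w | j < r.+1], xi (S r.+1) w)).
    by apply: eq_integral => w _; rewrite hE St.
  rewrite (transition_law kE S0 S1 SS m_gt0 levyX fX lrbL xiL mphi phi0) Sr St.
  rewrite [RHS]integral_indicM; apply: eq_integral => v _.
  exact: transition_kernel_indicM.
split; first exact: measurable_history.
- by move=> C mC; exact: law.
- move=> C mC; have := law C setT mC measurableT.
  rewrite preimage_setT setTI => ->; apply: eq_integral => v _.
  rewrite -Sr -(transition_kernel_mass S0 S1 SS m_gt0 fX lrbL) ?St.
    rewrite /transition_kernel; apply: eq_integral => y _.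
    by rewrite indicE in_setT.
  move=> sr0; apply: history0_sum; apply: (strict_time_eq0 S0 _ sr0) => j jr.
  by apply: SS; exact: (leq_trans jr (ltnW (leqnSn _))).
Qed.

End glp_posteriors.

(** * The Markov property and the transition law *)

Section versions.
Context (R : realType) d d' (Om : measurableType d) (S : measurableType d')
  (P : probability Om R) (X : R -> {RV P >-> S}) (s : R).
Hypothesis s0 : (0 <= s)%R.

Lemma preimage_in_filtration (C : set S) : measurable C ->
  natural_filtration X s (X s @^-1` C).
Proof.
move=> mC; apply: sub_sigma_algebra; exists s => /=; first by rewrite s0 lexx.
by exists C => //; rewrite setTI.
Qed.

Variables (E : set Om) (g : S -> \bar R).
Hypotheses (mg : measurable_fun setT g) (g0 : forall x, 0 <= g x)
  (gE : forall C, natural_filtration X s C ->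
     P (E `&` C) = \int[P]_(w in C) g (X s w)).

Lemma posterior_is_cprob_given : is_cprob_given E (X s) g.
Proof.
split=> // C mC; rewrite gE; last exact: preimage_in_filtration.
have mX : measurable_fun setT (X s) by exact: measurable_funP.
rewrite (ge0_integral_pushforward mX)//.
exact: (measurable_funS _ _ mg).
Qed.

(** A function of the present that is a conditional probability given the past
is also one given the present, as the present is part of the past. *)
Lemma posterior_common_version : exists h : Om -> \bar R,
  is_cprob P (preimage_set_system setT (X s) measurable) E h /\
  is_cprob P (natural_filtration X s) E h.
Proof.
have mgB (B : set (\bar R)) : measurable B -> measurable (g @^-1` B).
  by move=> mB; have := mg measurableT mB; rewrite setTI.
exists (g \o X s); split; split.
- by move=> B mB; exists (g @^-1` B); [exact: mgB|rewrite setTI].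
- move=> _ [C mC <-]; rewrite setTI; apply: gE.
  exact: preimage_in_filtration.
- by move=> B mB; exact: (preimage_in_filtration (mgB _ mB)).
- exact: gE.
Qed.

End versions.

(** The Markov property for equal times: the event is known at time [s]. *)
Lemma current_state_common_version (R : realType) d d' (Om : measurableType d)
    (S : measurableType d') (P : probability Om R) (X : R -> {RV P >-> S})
    (s : R) (A : set S) : (0 <= s)%R -> measurable A ->
  exists h : Om -> \bar R,
    is_cprob P (preimage_set_system setT (X s) measurable) (X s @^-1` A) h /\
    is_cprob P (natural_filtration X s) (X s @^-1` A) h.
Proof.
move=> s0 mA; apply: (posterior_common_version s0 (g := fun x => (\1_A x)%:E)).
  exact: emeasurable_indic.
move=> C FC.
have mX : measurable_fun setT (X s) by exact: measurable_funP.
have mC : measurable C.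
  apply: smallest_sub FC; first exact: sigma_algebra_measurable.
  move=> _ [u _ [B mB <-]].
  have mXu : measurable_fun setT (X u) by exact: measurable_funP.
  exact: mXu.
have mXA : measurable (X s @^-1` A) by have := mX measurableT A mA; rewrite setTI.
transitivity (\int[P]_(w in C) (\1_(X s @^-1` A) w)%:E).
  by rewrite integral_indic.
by apply: eq_integral => w _; rewrite !indicE.
Qed.

Lemma divek (R : realFieldType) (x y : \bar R) : 0 < y < +oo -> x / y * y = x.
Proof.
move=> /andP[y0 yoo]; have yfin : y \is a fin_num by rewrite ge0_fin_numE// ltW.
by rewrite -muleA [_^-1 * _]muleC divee ?mule1// gt_eqF.
Qed.

Section glp_transition_law.
Context (R : realType) (n : nat) (m : n.+1.-tuple R).
Hypotheses (n_gt0 : (0 < n)%N) (m_gt0 : forall i, (0 < tnth m i)%R).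
Context (f : R -> R -> \bar R) (nu : probability R R).
Context d' (Om' : measurableType d') (P' : probability Om' R)
  (X : R -> {RV P' >-> R}).
Local Notation T := (sum_tuple m).
Hypotheses (fX : levy_densities T f X) (T0 : (0 < T)%R).
Local Notation mu := (levy_law X).
Local Notation state := (n.+1.-tuple R).

Let weighted_time_in (c : R) (i : nat) : (0 < c <= 1)%R -> (i < n.+1)%N ->
  (0 < c * nth 0 m i <= T)%R.
Proof.
move=> /andP[c0 c1] ni; have mi0 : (0 < nth 0 m i)%R.
  by have := m_gt0 (Ordinal ni); rewrite (tnth_nth 0%R).
rewrite mulr_gt0//=; apply: (@le_trans _ _ (nth 0 m i)%R).
  by rewrite ler_piMl// ltW.
rewrite /sum_tuple (bigD1 (Ordinal ni))//= (tnth_nth 0%R)/= lerDl.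
by apply: sumr_ge0 => j _; exact: ltW.
Qed.

Let weighted_density (c : R) (i : nat) : (0 < c <= 1)%R -> (i < n.+1)%N ->
  has_density (mu (c * nth 0 m i)%R) (f (c * nth 0 m i)%R).
Proof. by move=> c01 ni; apply: (levy_law_density fX); exact: weighted_time_in. Qed.

(** [lebesgue_int_tadd] applied to all factors but the densities. *)
Lemma transition_kernelE s t (A : set state) (x : state) :
  (0 <= s)%R -> (s < t)%R -> (t < 1)%R -> measurable A ->
  lebesgue_int (fun y : state => (\1_A y)%:E *
    (Theta f nu T t (sum_tuple y) / Theta f nu T s (sum_tuple x) *
     \prod_(i < n.+1) f ((t - s) * tnth m i)%R (tnth y i - tnth x i)%R)) =
  transition_kernel m f nu X s t (fun y => (\1_A y)%:E) x /
    Theta f nu T s (sum_tuple x).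
Proof.
move=> s0 st t1 mA.
have t01 : (0 <= t < 1)%R by rewrite t1 andbT (le_trans s0)// ltW.
have s01 : (0 <= s < 1)%R by rewrite s0 (lt_trans st).
have ts01 : (0 < t - s <= 1)%R.
  by rewrite subr_gt0 st lerBlDr (le_trans (ltW t1))// lerDl.
have mTheta : measurable_fun setT (fun y : state => Theta f nu T t (sum_tuple y)).
  exact: (measurableT_comp (measurable_Theta nu fX T0 t01)
    (@measurable_sum_tuple R n.+1)).
have Theta0 a y : (0 <= a < 1)%R -> 0 <= Theta f nu T a y.
  by move=> a01; exact: (theta_ge0 nu fX T0).
pose q := (Theta f nu T s (sum_tuple x))^-1.
have q0 : 0 <= q by rewrite inve_ge0 Theta0.
have mpsi : measurable_fun setT
    (fun y : state => (\1_A y : R)%:E * Theta f nu T t (sum_tuple y)).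
  by apply: emeasurable_funM => //; exact: emeasurable_indic.
have psi0 (y : state) : 0 <= (\1_A y : R)%:E * Theta f nu T t (sum_tuple y).
  by rewrite mule_ge0// Theta0.
transitivity (lebesgue_int (fun y : state =>
    ((\1_A y)%:E * Theta f nu T t (sum_tuple y) * q) *
    \prod_(i < n.+1) f ((t - s) * nth 0 m i)%R (tnth y i - tnth x i)%R)).
  congr lebesgue_int; apply/funext => y; rewrite !muleA; congr (_ * _).
  by apply: eq_bigr => i _; rewrite (tnth_nth 0%R m).
rewrite (@lebesgue_int_tadd R n.+1 (fun i => mu ((t - s) * nth 0 m i)%R)
  (fun i => f ((t - s) * nth 0 m i)%R) x (fun y : state =>
    ((\1_A y)%:E * Theta f nu T t (sum_tuple y) * q))).
- rewrite ge0_integralZr//.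
  exact: (measurableT_comp mpsi (measurableT_comp (@measurable_tadd R n.+1)
    (pair1_measurable x))).
- by move=> i ni; exact: weighted_density.
- by apply: emeasurable_funM => //; exact: measurable_cst.
- by move=> y; rewrite mule_ge0.
Qed.

Definition terminal_event (A : set (n.-tuple R)) (B : set R) : set state :=
  [set z | A (front_tuple z) /\ B (tnth z ord_max)].

Lemma measurable_terminal_event A B : measurable A -> measurable B ->
  measurable (terminal_event A B).
Proof.
move=> mA mB; apply: measurableI.
  have mfront : measurable_fun setT (@front_tuple R n).
    by apply: measurable_mktuple => i; exact: measurable_tnth.
  by have := mfront measurableT A mA; rewrite setTI.
have mlast : measurable_fun setT (fun z : state => tnth z ord_max).
  exact: measurable_tnth.
by have := mlast measurableT B mB; rewrite setTI.
Qed.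

(** The last coordinate of the terminal state is not integrated with respect to
Lebesgue measure: it lies in [B] if [z = L_T] lies in the translate of [B] by
the sum of the other coordinates.  The time [tau s] is such that
[T (1 - tau s)] is the time [(1 - s) m_n] that the last coordinate has left. *)
Lemma terminal_kernelE s (A : set (n.-tuple R)) (B : set R) (x : state) :
  let tau t := (1 - tnth m ord_max * (1 - t) / T)%R in
  (0 <= s < 1)%R -> measurable A -> measurable B ->
  lebesgue_int (fun z : n.-tuple R => (\1_A z)%:E *
    (theta f nu T (tau s) (translate B (sum_tuple z))
       (tnth x ord_max + sum_tuple z)%R / Theta f nu T s (sum_tuple x) *
     \prod_(i < n) f ((1 - s) * tnth m (widen_ord (leqnSn n) i))%R
       (tnth z i - tnth x (widen_ord (leqnSn n) i))%R)) =
  terminal_kernel m f nu X s (fun y => (\1_(terminal_event A B) y)%:E) x /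
    Theta f nu T s (sum_tuple x).
Proof.
move=> tau s01 mA mB; have /andP[s0 s1] := s01.
have mtime := terminal_time_in n_gt0 m_gt0 s01; have /andP[l0 lT] := mtime.
have tauE : (T * (1 - tau s) = (1 - s) * tnth m ord_max)%R.
  by rewrite /tau subKr mulrC divfK ?gt_eqF// mulrC.
have tau01 : (0 < tau s < 1)%R.
  rewrite /tau subr_gt0 gtrBl ltr_pdivrMr// mul1r [(_ * (1 - s))%R]mulrC lT/=.
  by rewrite divr_gt0.
have taun0 : (tau s == 0%R) = false by apply: gt_eqF; case/andP: tau01.
have s11 : (0 < 1 - s <= 1)%R by rewrite subr_gt0 s1 gerBl.
pose q := (Theta f nu T s (sum_tuple x))^-1.
have q0 : 0 <= q by rewrite inve_ge0 (theta_ge0 nu fX T0).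
pose psi (z : n.-tuple R) := (\1_A z : R)%:E *
  theta f nu T (tau s) (translate B (sum_tuple z)) (tnth x ord_max + sum_tuple z)%R.
have mpsi : measurable_fun setT psi.
  apply: emeasurable_funM; first exact: emeasurable_indic.
  have msum := @measurable_sum_tuple R n.
  apply: (measurable_theta_translate nu fX T0 tau01 mB msum).
  by apply: measurable_funD => //; exact: measurable_cst.
have psi0 z : 0 <= psi z.
  rewrite mule_ge0//; apply: (theta_ge0 nu fX T0).
  by have /andP[/ltW -> ->] := tau01.
transitivity (lebesgue_int (fun z : n.-tuple R => (psi z * q) *
    \prod_(i < n) f ((1 - s) * nth 0 m i)%R
      (tnth z i - tnth (front_tuple x) i)%R)).
  congr lebesgue_int; apply/funext => z; rewrite /psi !muleA; congr (_ * _).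
  by apply: eq_bigr => i _; rewrite tnth_mktuple (tnth_nth 0%R m).
rewrite (@lebesgue_int_tadd R n (fun i => mu ((1 - s) * nth 0 m i)%R)
  (fun i => f ((1 - s) * nth 0 m i)%R) (front_tuple x) (fun z => psi z * q)).
- rewrite ge0_integralZr//; last first.
    exact: (measurableT_comp mpsi (measurableT_comp (@measurable_tadd R n)
      (pair1_measurable (front_tuple x)))).
  congr (_ * _); apply: eq_integral => y _; set zeta := tadd _ y.
  rewrite /psi /theta taun0 tauE.
  have eventE z : terminal_event A B (terminal_state zeta z) =
      (A zeta /\ translate B (sum_tuple zeta) z).
    rewrite /terminal_event/= terminal_state_last; congr (A _ /\ _).
    by apply: eq_from_tnth => i; rewrite tnth_mktuple terminal_state_front.
  rewrite [X in _ * X]integral_indicM.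
  have [Az|nAz] := pselect (A zeta).
    rewrite indicE mem_set// mul1e; apply: eq_integral => z _.
    congr (_%:E * _); rewrite !indicE; congr (nat_of_bool _)%:R.
    by apply/asbool_equiv_eq; rewrite eventE; split=> [|[]].
  rewrite indicE memNset// mul0e; apply/esym/integral0_eq => z _.
  by rewrite indicE memNset ?mul0e// eventE => -[].
- by move=> i ni; apply: weighted_density => //; exact: ltnW.
- by apply: emeasurable_funM => //; exact: measurable_cst.
- by move=> y; rewrite mule_ge0.
Qed.

End glp_transition_law.

(* The dimension is n.+1 >= 2; the last coordinate has index ord_max. *)
Theorem proposition3p5 (R : realType) (n : nat) (m : n.+1.-tuple R)
    (f : R -> R -> \bar R) (nu : probability R R)
    (d : measure_display) (Om : measurableType d) (P : probability Om R)
    (xi : R -> {RV P >-> n.+1.-tuple R}) :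
  (2 <= n.+1)%N ->
  (forall i, (0 < tnth m i)%R) ->
  no_continuous_singular_part nu ->
  generalised_liouville_process m f nu xi ->
  let u : R := sum_tuple m in
  let tau : R -> R := fun t => (1 - tnth m ord_max * (1 - t) / u)%R in
  [/\ markov_process 1 xi,
      forall (s : R) (A : set (n.-tuple R)) (B : set R),
        (0 <= s < 1)%R -> measurable A -> measurable B ->
        is_cprob_given
          [set w | A (front_tuple (xi 1%R w)) /\ B (tnth (xi 1%R w) ord_max)]
          (xi s)
          (fun x => lebesgue_int (fun z : n.-tuple R =>
             (\1_A z)%:E *
             (theta f nu u (tau s) (translate B (sum_tuple z))
                (tnth x ord_max + sum_tuple z)%R
              / Theta f nu u s (sum_tuple x)
              * \prod_(i < n)
                  f ((1 - s) * tnth m (widen_ord (leqnSn n) i))%R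
                    (tnth z i - tnth x (widen_ord (leqnSn n) i))%R))) &
      forall (s t : R) (A : set (n.+1.-tuple R)),
        (0 <= s)%R -> (s < t)%R -> (t < 1)%R -> measurable A ->
        is_cprob_given
          [set w | A (xi t w)]
          (xi s)
          (fun x => lebesgue_int (fun y : n.+1.-tuple R =>
             (\1_A y)%:E *
             (Theta f nu u t (sum_tuple y) / Theta f nu u s (sum_tuple x)
              * \prod_(i < n.+1)
                  f ((t - s) * tnth m i)%R (tnth y i - tnth x i)%R)))].
Proof.
move=> n2 m_gt0 _ [_ [d2 [Om2 [P2 [L [lrbL xiL]]]]]] u tau.
have n_gt0 : (0 < n)%N by [].
have [d' [Om' [P' [X [levyX fX]]]]] := lrb_levy lrbL.
have T0 : (0 < u)%R := lrb_pos lrbL.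
have Theta0 s x : (0 <= s < 1)%R -> 0 <= Theta f nu u s x.
  by move=> s01; exact: (theta_ge0 nu fX T0).
have mTheta s : (0 <= s < 1)%R ->
    measurable_fun setT (fun x : n.+1.-tuple R => Theta f nu u s (sum_tuple x)).
  move=> s01; exact: (measurableT_comp (measurable_Theta nu fX T0 s01)
    (@measurable_sum_tuple R n.+1)).
pose ratio (K : n.+1.-tuple R -> \bar R) s x := K x / Theta f nu u s (sum_tuple x).
have mratio K s : (0 <= s < 1)%R -> measurable_fun setT K ->
    measurable_fun setT (ratio K s).
  move=> s01 mK; apply: emeasurable_funM => //.
  by apply: measurable_inve; [exact: mTheta|move=> x; exact: Theta0].
have ratio0 K s : (0 <= s < 1)%R -> (forall x, 0 <= K x) ->
    forall x, 0 <= ratio K s x.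
  by move=> s01 K0 x; rewrite mule_ge0// inve_ge0 Theta0.
pose K1 (A : set (n.+1.-tuple R)) s :=
  terminal_kernel m f nu X s (fun y => (\1_A y)%:E).
pose Kt (A : set (n.+1.-tuple R)) s t :=
  transition_kernel m f nu X s t (fun y => (\1_A y)%:E).
have mK1 A s : (0 <= s < 1)%R -> measurable A ->
    measurable_fun setT (ratio (K1 A s) s).
  move=> s01 mA; apply: (mratio _ _ s01).
  by apply: (measurable_terminal_kernel n_gt0 m_gt0 nu fX s01) => //;
    exact: emeasurable_indic.
have K10 A s : (0 <= s < 1)%R -> forall x, 0 <= ratio (K1 A s) s x.
  move=> s01; apply: (ratio0 _ _ s01) => x.
  by apply: (terminal_kernel_ge0 n_gt0 m_gt0 nu fX _ s01).
have post1 A s : (0 <= s < 1)%R -> measurable A ->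
    forall C, natural_filtration xi s C ->
    P (xi 1%R @^-1` A `&` C) = \int[P]_(w in C) ratio (K1 A s) s (xi s w).
  move=> s01 mA; apply: (terminal_posterior n_gt0 m_gt0 levyX fX lrbL xiL s01 mA).
  - exact: mK1.
  - exact: K10.
  - by move=> x; exact: divek.
have mKt A s t : (0 <= s)%R -> (s < t)%R -> (t < 1)%R -> measurable A ->
    measurable_fun setT (ratio (Kt A s t) s).
  move=> s0 st t1 mA; apply: mratio; first by rewrite s0 (lt_trans st).
  apply: (measurable_transition_kernel fX lrbL) => //.
    by rewrite t1 andbT (le_trans s0)// ltW.
  exact: emeasurable_indic.
have Kt0 A s t : (0 <= s)%R -> (s < t)%R -> (t < 1)%R ->
    forall x, 0 <= ratio (Kt A s t) s x.
  move=> s0 st t1; apply: ratio0; first by rewrite s0 (lt_trans st).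
  move=> x; apply: (transition_kernel_ge0 fX lrbL) => //.
  by rewrite t1 andbT (le_trans s0)// ltW.
have postt A s t : (0 <= s)%R -> (s < t)%R -> (t < 1)%R -> measurable A ->
    forall C, natural_filtration xi s C ->
    P (xi t @^-1` A `&` C) = \int[P]_(w in C) ratio (Kt A s t) s (xi s w).
  move=> s0 st t1 mA.
  apply: (transition_posterior n_gt0 m_gt0 levyX fX lrbL xiL s0 st t1 mA).
  - exact: mKt.
  - exact: Kt0.
  - by move=> x; exact: divek.
split.
- move=> s t s0; rewrite le_eqVlt => /predU1P[<- _ A mA|st].
    exact: current_state_common_version.
  rewrite le_eqVlt => /predU1P[t1 A mA|t1 A mA].
    have s01 : (0 <= s < 1)%R by rewrite s0 -t1.
    rewrite t1; exact: (posterior_common_version s0 (mK1 A s s01 mA)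
      (post1 A s s01 mA)).
  exact: (posterior_common_version s0 (mKt A s t s0 st t1 mA)
    (postt A s t s0 st t1 mA)).
- move=> s A B s01 mA mB; have s0 : (0 <= s)%R by case/andP: s01.
  have mE := measurable_terminal_event mA mB.
  have := posterior_is_cprob_given s0 (mK1 _ s s01 mE) (K10 _ s s01)
    (post1 _ s s01 mE).
  congr (is_cprob_given _ _ _); apply/funext => x; apply/esym.
  exact: (terminal_kernelE n_gt0 m_gt0 nu fX T0 x s01 mA mB).
- move=> s t A s0 st t1 mA.
  have := posterior_is_cprob_given s0 (mKt _ s t s0 st t1 mA) (Kt0 A s t s0 st t1)
    (postt A s t s0 st t1 mA).
  congr (is_cprob_given _ _ _); apply/funext => x; apply/esym.
  exact: (transition_kernelE m_gt0 nu fX T0 x s0 st t1 mA).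
Qed.
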